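(* Let $k>0$ be an even integer and let $\theta_k\colon\mathrm{SL}(2,\mathbb{Z})\to\mathrm{Bir}(\mathbb{P}^2)$ be the embedding defined in the context. Let $m$ be a positive integer, and let $a_1,\dots,a_m,b_1,\dots,b_m\in\{\pm1\}$. The birational map $$\theta_k\left(S^{b_m}(RS)^{a_m}\cdots S^{b_1}(RS)^{a_1}\right)$$ has dynamical degree $k^{2m}$. In particular, the map $\theta_k$ is a hyperbolic embedding and the set of all dynamical degrees of elements of $\theta_k(\mathrm{SL}(2,\mathbb{Z}))$ is $\{1,k^2,k^4,k^6,\dots\}$.
   Context: $\mathrm{Bir}(\mathbb{P}^2)$ is the group of birational self-maps of the complex projective plane; $(f_1:f_2:f_3)$ denotes $(x:y:z)\dashrightarrow(f_1:f_2:f_3)$. $R=\begin{bmatrix}1&1\\0&1\end{bmatrix}$, $S=\begin{bmatrix}0&1\\-1&0\end{bmatrix}$ generate $\mathrm{SL}(2,\mathbb{Z})=\langle R,S\mid S^4=(RS)^3=1,\ S^2(RS)=(RS)S^2\rangle$. Let $\theta_e\colon\begin{bmatrix}a&b\\c&d\end{bmatrix}\mapsto(ax+by:cx+dy:z)$. The group $\theta_e(\mathrm{SL}(2,\mathbb{Z}))$ preserves the line $L_z$ of equation $z=0$ and acts on it through $\mathrm{PSL}(2,\mathbb{Z})\subset\mathrm{PSL}(2,\mathbb{C})=\mathrm{Aut}(L_z)$. Fix $\mu\in\mathbb{C}^*$ such that $p=(\mu:1:0)\in L_z$ has trivial isotropy group under $\mathrm{PSL}(2,\mathbb{Z})$,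 and an even integer $k>0$. Let $\psi'=(x^k:yx^{k-1}+z^k:zx^{k-1})$, $\tau=(x+\mu y:y:z)$ and $\psi=\tau\psi'\tau^{-1}$ (so that the unique proper base-point of $\psi$ is $p$). Then $\theta_k$ is the homomorphism determined by $\theta_k(S)=\theta_e(S)=(y:-x:z)$ and $\theta_k(RS)=\psi\,\theta_e(RS)\,\psi^{-1}$. For $f\in\mathrm{Bir}(\mathbb{P}^2)$, its dynamical degree is $\lambda(f)=\lim_n(\deg f^n)^{1/n}$; $f$ is hyperbolic if $\lambda(f)>1$. An embedding (injective homomorphism) of $\mathrm{SL}(2,\mathbb{Z})$ into $\mathrm{Bir}(\mathbb{P}^2)$ is hyperbolic if each element of infinite order of its image is hyperbolic. *)

(* Defs.v *)
From HB Require Import structures.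
From mathcomp Require Import all_boot all_order all_algebra.
From mathcomp Require Import mpoly complex.
From mathcomp Require Import boolp classical_sets reals topology normedtype sequences exp.
From mathcomp Require Import ring zify.

Set Implicit Arguments.
Unset Strict Implicit.
Unset Printing Implicit Defensive.
Import Order.TTheory GRing.Theory Num.Theory.
Import numFieldNormedType.Exports.
Local Open Scope ring_scope.
Local Open Scope quotient_scope.

Section Cremona.
Variable F : fieldType.

Definition triple := 3.-tuple {mpoly F[3]}.

Implicit Types f g h : triple.

Definition nonzero f : Prop := exists i, tnth f i != 0.

Definition ratmap f : Prop :=
  (exists d, forall i, tnth f i \is d.-homog) /\ nonzero f.

(* For nonzero triples: equality in P^2 wherever both are defined. *)
Definition same_map f g : bool :=
  [forall i, forall j, tnth f i * tnth g j == tnth f j * tnth g i].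

Definition comp3 f g : triple := [tuple tnth f i \mPo g | i < 3].

Definition id3 : triple := [tuple 'X_i | i < 3].

(* f \o g is the identity as a rational map; the nonvanishing is needed because
   the composite of two rational maps need not be defined. *)
Definition inverse3 f g : Prop :=
  nonzero (comp3 f g) /\ same_map (comp3 f g) id3.

Definition birational f : Prop :=
  ratmap f /\ exists g, [/\ ratmap g, inverse3 f g & inverse3 g f].

Lemma same_mapP f g :
  reflect (forall i j, tnth f i * tnth g j = tnth f j * tnth g i) (same_map f g).
Proof.
apply: (iffP forallP) => [h i j|h i]; first by have /forallP/(_ j)/eqP := h i.
by apply/forallP => j; apply/eqP.
Qed.

Lemma same_map_refl : reflexive same_map.
Proof. by move=> f; apply/same_mapP => i j; rewrite mulrC. Qed.

Lemma same_map_symP f g : same_map f g -> same_map g f.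
Proof.
by move=> /same_mapP h; apply/same_mapP => i j; rewrite mulrC h mulrC.
Qed.

Lemma same_map_sym : ssrbool.symmetric same_map.
Proof. by move=> f g; apply/idP/idP => /same_map_symP. Qed.

Lemma same_map_tr f g h :
  nonzero g -> same_map f g -> same_map g h -> same_map f h.
Proof.
move=> [k gk] /same_mapP fg /same_mapP gh; apply/same_mapP => i j.
apply: (mulfI gk); rewrite [LHS]mulrCA gh mulrA fg -mulrA.
by rewrite -(gh k i) mulrCA.
Qed.

Lemma scaled_same_map (a b : {mpoly F[3]}) f g : a != 0 ->
  (forall i, a * tnth f i = b * tnth g i) -> same_map f g.
Proof.
move=> a0 h; apply/same_mapP => i j; apply: (mulfI a0).
by rewrite mulrA h mulrA h mulrAC.
Qed.

Lemma tnth_comp3 f g i : tnth (comp3 f g) i = tnth f i \mPo g.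
Proof. by rewrite tnth_mktuple. Qed.

Lemma tnth_id3 i : tnth id3 i = 'X_i.
Proof. by rewrite tnth_mktuple. Qed.

#[local] Opaque comp3 id3.

Lemma comp_mpoly_scale d (p : {mpoly F[3]}) (a b : {mpoly F[3]}) f g :
  p \is d.-homog -> (forall i, a * tnth f i = b * tnth g i) ->
  a ^+ d * (p \mPo f) = b ^+ d * (p \mPo g).
Proof.
move=> /dhomogP hp h; rewrite !comp_mpolyEX !mulr_sumr.
apply: eq_big_seq => m /hp <-; rewrite -!scalerAr !comp_mpolyX; congr (_ *: _).
by rewrite /= mdegE -!prodrXr -!big_split /=; apply: eq_bigr => i _; rewrite -!exprMn h.
Qed.

Lemma comp3A f g h : comp3 f (comp3 g h) = comp3 (comp3 f g) h.
Proof.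
apply: eq_from_tnth => i; rewrite !tnth_comp3.
rewrite [tnth f i \mPo g]comp_mpolyE raddf_sum comp_mpolyE /=.
apply: eq_bigr => m _; rewrite comp_mpolyZ rmorph_prod /=; congr (_ *: _).
by apply: eq_bigr => j _; rewrite rmorphXn /= tnth_comp3.
Qed.

Lemma comp3f1 f : comp3 f id3 = f.
Proof. by apply: eq_from_tnth => i; rewrite tnth_comp3 comp_mpoly_id. Qed.

Lemma comp31f f : comp3 id3 f = f.
Proof.
by apply: eq_from_tnth => i; rewrite tnth_comp3 tnth_id3 comp_mpolyXU -tnth_nth.
Qed.

Lemma comp3_homog f g d e : (forall i, tnth f i \is d.-homog) ->
  (forall i, tnth g i \is e.-homog) ->
  forall i, tnth (comp3 f g) i \is (e * d).-homog.
Proof.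
move=> hf hg i; rewrite tnth_comp3 comp_mpolyEX.
rewrite big_seq; apply: rpred_sum => m hm; apply: rpredZ; rewrite comp_mpolyX.
have /dhomogP/(_ m hm) /= <- := hf i.
rewrite mdegE big_distrr /=.
elim/big_rec2: _ => [|j q n _ hq]; first exact: dhomog1.
by apply: dhomogM => //; apply: dhomogMn.
Qed.

Lemma same_map_compl f f' g : same_map f f' -> same_map (comp3 f g) (comp3 f' g).
Proof.
move=> /same_mapP h; apply/same_mapP => i j.
by rewrite !tnth_comp3 -!rmorphM /= h.
Qed.

Lemma same_map_scale f g : nonzero f -> nonzero g -> same_map f g ->
  exists a b, [/\ a != 0, b != 0 & forall i, a * tnth f i = b * tnth g i].
Proof.
move=> [i fi] [j gj] /same_mapP h.
exists (tnth g i), (tnth f i); split=> // [|k]; last by rewrite mulrC h mulrC.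
apply: contraNneq gj => gi; have := h i j; rewrite gi mulr0 => /eqP.
rewrite mulf_eq0 => /orP[] // fi0; by rewrite fi0 in fi.
Qed.

Lemma same_map_compr f g g' : ratmap f -> nonzero g -> nonzero g' ->
  same_map g g' -> same_map (comp3 f g) (comp3 f g').
Proof.
move=> [[d hf] _] g0 g'0 /(same_map_scale g0 g'0)[a [b [a0 b0 h]]].
apply: (@scaled_same_map (a ^+ d) (b ^+ d)); first by rewrite expf_neq0.
by move=> i; rewrite !tnth_comp3; apply: comp_mpoly_scale.
Qed.

Lemma mpolyXU_neq0 (i : 'I_3) : 'X_i != 0 :> {mpoly F[3]}.
Proof.
apply/eqP => /(congr1 (mcoeff U_(i)%MM)); rewrite mcoeffX eqxx mcoeff0.
by move/eqP; rewrite oner_eq0.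
Qed.

Lemma id3_nonzero : nonzero id3.
Proof. by exists ord0; rewrite tnth_id3 mpolyXU_neq0. Qed.

Lemma comp3_nonzero f g : ratmap f -> birational g -> nonzero (comp3 f g).
Proof.
move=> [[d hf] [i fi]] [_ [h [_ [gh0 gh] _]]].
have [a [b [a0 b0 e]]] := same_map_scale gh0 id3_nonzero gh.
exists i; apply: contraNneq fi => fg0.
have := comp_mpoly_scale (hf i) e.
rewrite -!tnth_comp3 (comp3A f g h) (comp3f1 f) tnth_comp3 fg0 raddf0 mulr0 => /esym/eqP.
by rewrite mulf_eq0 => /orP[|//]; rewrite expf_eq0 => /andP[_ b1]; rewrite b1 in b0.
Qed.

Lemma comp3_ratmap f g : ratmap f -> birational g -> ratmap (comp3 f g).
Proof.
move=> hf hg; split; last exact: comp3_nonzero.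
have [[d df] _] := hf; have [[[e dg] _] _] := hg.
by exists (e * d)%N; apply: comp3_homog.
Qed.

Lemma inverse_birational f g :
  ratmap f -> ratmap g -> inverse3 f g -> inverse3 g f -> birational g.
Proof. by move=> hf hg fg gf; split=> //; exists f; split. Qed.

Lemma comp3_inverse f g f' g' : birational f -> birational g ->
  birational f' -> birational g' -> inverse3 f f' -> inverse3 g g' ->
  inverse3 (comp3 f g) (comp3 g' f').
Proof.
move=> hf hg hf' hg' [ff0 ff] [gg0 gg].
have rfg : ratmap (comp3 f g) by apply: comp3_ratmap hg; case: hf.
have gg'f0 : nonzero (comp3 (comp3 g g') f').
  by apply: comp3_nonzero hf'; apply: comp3_ratmap hg'; case: hg.
have e : comp3 (comp3 f g) (comp3 g' f') = comp3 f (comp3 (comp3 g g') f').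
  by rewrite -(comp3A f g (comp3 g' f')) (comp3A g g' f').
split.
  rewrite (comp3A (comp3 f g) g' f'); apply: comp3_nonzero hf'.
  exact: comp3_ratmap.
rewrite e.
have f'0 : nonzero f' by case: hf' => -[].
apply: (same_map_tr ff0 _ ff).
apply: (same_map_compr _ gg'f0 f'0); first by case: hf.
by have := same_map_compl f' gg; rewrite comp31f.
Qed.

Lemma comp3_birational f g :
  birational f -> birational g -> birational (comp3 f g).
Proof.
move=> hf hg; split; first by apply: comp3_ratmap hg; case: hf.
have [rf [f' [rf' ff f'f]]] := hf; have [rg [g' [rg' gg g'g]]] := hg.
have hf' := inverse_birational rf rf' ff f'f.
have hg' := inverse_birational rg rg' gg g'g.
exists (comp3 g' f'); split; first exact: comp3_ratmap.
- exact: comp3_inverse.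
- exact: comp3_inverse.
Qed.

Lemma id3_birational : birational id3.
Proof.
have r : ratmap id3.
  split; last exact: id3_nonzero.
  by exists 1%N => i; rewrite tnth_id3 dhomogX /= mdeg1.
split=> //; exists id3.
have h : inverse3 id3 id3.
  by rewrite /inverse3 comp31f; split; [apply: id3_nonzero|apply: same_map_refl].
by split.
Qed.

Definition birtriple : Type := {f : triple | `[< birational f >]}.
HB.instance Definition _ := Choice.on birtriple.

Definition btriple f (hf : birational f) : birtriple := exist _ f (asboolT hf).

Lemma birtripleP (f : birtriple) : birational (val f).
Proof. by apply/asboolP/(valP f). Qed.

Lemma birtriple_nz (f : birtriple) : nonzero (val f).
Proof. by case: (birtripleP f) => -[]. Qed.

Definition same_bir (f g : birtriple) : bool := same_map (val f) (val g).

Lemma same_bir_refl : reflexive same_bir.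
Proof. by move=> f; apply: same_map_refl. Qed.

Lemma same_bir_sym : ssrbool.symmetric same_bir.
Proof. by move=> f g; apply: same_map_sym. Qed.

Lemma same_bir_trans : transitive same_bir.
Proof. by move=> g f h; apply: same_map_tr; apply: birtriple_nz. Qed.

Canonical same_bir_equiv :=
  EquivRel same_bir same_bir_refl same_bir_sym same_bir_trans.

Definition Bir : Type := {eq_quot same_bir}.
HB.instance Definition _ := Choice.on Bir.
HB.instance Definition _ := EqQuotient.on Bir.

Definition bir f (hf : birational f) : Bir := \pi_Bir (btriple hf).

Lemma ex_inverse (f : birtriple) :
  exists g : birtriple, inverse3 (val f) (val g) /\ inverse3 (val g) (val f).
Proof.
have [rf [g [rg fg gf]]] := birtripleP f.
exact: (ex_intro _ (btriple (inverse_birational rf rg fg gf)) (conj fg gf)).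
Qed.

Definition bir1 : Bir := bir id3_birational.
Definition birM (f g : Bir) : Bir :=
  bir (comp3_birational (birtripleP (repr f)) (birtripleP (repr g))).
Definition birV (f : Bir) : Bir := \pi_Bir (sval (cid (ex_inverse (repr f)))).

Lemma bir_eq f g (hf : birational f) (hg : birational g) :
  bir hf = bir hg <-> same_map f g.
Proof.
by split=> [/eqP|h]; [rewrite eqmodE|apply/eqP; rewrite eqmodE].
Qed.

Lemma bir_repr (f : Bir) : bir (birtripleP (repr f)) = f.
Proof.
by rewrite -[RHS]reprK; apply/eqP; rewrite eqmodE; apply: same_map_refl.
Qed.

Lemma same_map_repr f (hf : birational f) : same_map (val (repr (bir hf))) f.
Proof. by apply/(bir_eq (birtripleP _) hf); rewrite bir_repr. Qed.

Lemma birME f g (hf : birational f) (hg : birational g) :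
  birM (bir hf) (bir hg) = bir (comp3_birational hf hg).
Proof.
have [[rf _] [rg _]] := (hf, hg).
have hf' := birtripleP (repr (bir hf)); have hg' := birtripleP (repr (bir hg)).
apply/bir_eq; apply: (same_map_tr (comp3_nonzero rf hg')).
  exact/same_map_compl/same_map_repr.
apply: (same_map_compr rf (birtriple_nz _)); first by case: rg.
exact: same_map_repr.
Qed.

Lemma bir_ind (P : Bir -> Prop) :
  (forall f (hf : birational f), P (bir hf)) -> forall p : Bir, P p.
Proof. by move=> h p; rewrite -(bir_repr p). Qed.

Lemma birMA : associative birM.
Proof.
elim/bir_ind=> f hf; elim/bir_ind=> g hg; elim/bir_ind=> h hh.
by rewrite !birME; apply/bir_eq; rewrite comp3A same_map_refl.
Qed.

Lemma bir1M : left_id bir1 birM.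
Proof.
elim/bir_ind=> f hf; rewrite birME; apply/bir_eq.
by rewrite comp31f same_map_refl.
Qed.

Lemma birM1 : right_id bir1 birM.
Proof.
elim/bir_ind=> f hf; rewrite birME; apply/bir_eq.
by rewrite comp3f1 same_map_refl.
Qed.

Lemma birMV : right_inverse bir1 birV birM.
Proof.
move=> f; rewrite -{1}(bir_repr f) /birV; case: cid => g /= [[_ fg] _].
have -> : \pi_Bir g = bir (birtripleP g).
  by apply/eqP; rewrite eqmodE; apply: same_map_refl.
by rewrite birME; apply/bir_eq.
Qed.

Lemma birVM : left_inverse bir1 birV birM.
Proof.
move=> f; rewrite -{2}(bir_repr f) /birV; case: cid => g /= [_ [_ gf]].
have -> : \pi_Bir g = bir (birtripleP g).
  by apply/eqP; rewrite eqmodE; apply: same_map_refl.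
by rewrite birME; apply/bir_eq.
Qed.

HB.instance Definition _ := isGroup.Build Bir birMA bir1M birM1 birVM birMV.

Lemma birational_scale f g (a b : {mpoly F[3]}) : ratmap f -> ratmap g ->
  a != 0 -> b != 0 ->
  (forall i, tnth f i \mPo g = a * 'X_i) ->
  (forall i, tnth g i \mPo f = b * 'X_i) -> birational f.
Proof.
move=> rf rg a0 b0 fg gf; split=> //; exists g.
have H f' g' (c : {mpoly F[3]}) : c != 0 ->
    (forall i, tnth f' i \mPo g' = c * 'X_i) -> inverse3 f' g'.
  move=> c0 e; split; first by exists ord0; rewrite tnth_comp3 e mulf_neq0 // mpolyXU_neq0.
  apply: (@scaled_same_map 1 c); first exact: oner_neq0.
  by move=> i; rewrite mul1r tnth_comp3 tnth_id3.
by split=> //; [apply: H a0 _|apply: H b0 _].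
Qed.

Definition coprime3 f : Prop :=
  forall p : {mpoly F[3]}, (forall i, exists q, tnth f i = p * q) ->
  exists c : F, p = c%:MP.

End Cremona.

(* The degree of the components of a representative without common factor. *)
Definition degree (F : fieldType) (f : Bir F) : nat :=
  xget 0%N [set d | exists t (ht : birational t),
    [/\ f = bir ht, coprime3 t & forall i, tnth t i \is d.-homog]]%classic.

(* limn returns the default value 0 on a divergent sequence, so that an equation
   with a nonzero right-hand side includes convergence. *)
Definition dynamical_degree (R : realType) (f : Bir R[i]) : R :=
  limn (fun n : nat => (degree (f ^+ n)%g)%:R `^ n%:R^-1).

Definition hyperbolic (R : realType) (f : Bir R[i]) : Prop :=
  1 < dynamical_degree f.

Definition infinite_order (G : groupType) (g : G) : Prop :=
  forall n : nat, (0 < n)%N -> (g ^+ n)%g <> 1%g.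

Definition zexpg (G : groupType) (g : G) (z : int) : G :=
  match z with Posz n => (g ^+ n)%g | Negz n => (g ^- n.+1)%g end.

Section SL2Z.

Definition mx2 (a b c d : int) : 'M[int]_2 :=
  \matrix_(i, j) if i == 0 then (if j == 0 then a else b)
                 else (if j == 0 then c else d).

Definition SL2Z : Type := {M : 'M[int]_2 | \det M == 1}.
HB.instance Definition _ := Choice.on SL2Z.
HB.instance Definition _ := SubType.on SL2Z.

Implicit Types M N : SL2Z.

Lemma SL2Z_det M : \det (val M) = 1. Proof. exact/eqP/(valP M). Qed.

Lemma SL2Z_unit M : val M \in unitmx.
Proof. by rewrite unitmxE SL2Z_det unitr1. Qed.

Lemma SL2Z_1_subproof : \det (1%:M : 'M[int]_2) == 1.
Proof. by rewrite det1. Qed.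
Definition SL2Z_1 : SL2Z := exist _ 1%:M SL2Z_1_subproof.

Lemma SL2Z_M_subproof M N : \det (val M *m val N) == 1.
Proof. by rewrite det_mulmx !SL2Z_det mulr1. Qed.
Definition SL2Z_M M N : SL2Z := exist _ (val M *m val N) (SL2Z_M_subproof M N).

Lemma SL2Z_V_subproof M : \det (invmx (val M)) == 1.
Proof. by rewrite det_inv SL2Z_det invr1. Qed.
Definition SL2Z_V M : SL2Z := exist _ (invmx (val M)) (SL2Z_V_subproof M).

Lemma SL2Z_MA : associative SL2Z_M.
Proof. by move=> M N P; apply: val_inj; apply: mulmxA. Qed.
Lemma SL2Z_1M : left_id SL2Z_1 SL2Z_M.
Proof. by move=> M; apply: val_inj; apply: mul1mx. Qed.
Lemma SL2Z_M1 : right_id SL2Z_1 SL2Z_M.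
Proof. by move=> M; apply: val_inj; apply: mulmx1. Qed.
Lemma SL2Z_VM : left_inverse SL2Z_1 SL2Z_V SL2Z_M.
Proof. by move=> M; apply: val_inj; apply: mulVmx; apply: SL2Z_unit. Qed.
Lemma SL2Z_MV : right_inverse SL2Z_1 SL2Z_V SL2Z_M.
Proof. by move=> M; apply: val_inj; apply: mulmxV; apply: SL2Z_unit. Qed.

HB.instance Definition _ :=
  isGroup.Build SL2Z SL2Z_MA SL2Z_1M SL2Z_M1 SL2Z_VM SL2Z_MV.

Lemma det_mx2 a b c d : \det (mx2 a b c d) = a * d - b * c.
Proof.
rewrite (expand_det_row _ ord0) !big_ord_recl big_ord0 /cofactor !det_mx11.
by rewrite !mxE /=; ring.
Qed.

Lemma matR_subproof : \det (mx2 1 1 0 1) == 1.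
Proof. by rewrite det_mx2. Qed.
Lemma matS_subproof : \det (mx2 0 1 (-1) 0) == 1.
Proof. by rewrite det_mx2. Qed.

Definition matR : SL2Z := exist _ (mx2 1 1 0 1) matR_subproof.
Definition matS : SL2Z := exist _ (mx2 0 1 (-1) 0) matS_subproof.

(* S^{b_m} (RS)^{a_m} ... S^{b_1} (RS)^{a_1}: the leftmost factor has the
   largest index, hence rev_ord. *)
Definition wordSR m (a b : 'I_m -> int) : SL2Z :=
  (\prod_(i < m) (zexpg matS (b (rev_ord i)) *
                  zexpg (matR * matS) (a (rev_ord i))))%g.

End SL2Z.

Section Maps.
Variable F : fieldType.
Local Notation x := ('X_(@Ordinal 3 0 isT) : {mpoly F[3]}).
Local Notation y := ('X_(@Ordinal 3 1 isT) : {mpoly F[3]}).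
Local Notation z := ('X_(@Ordinal 3 2 isT) : {mpoly F[3]}).

Definition tri (p q r : {mpoly F[3]}) : triple F := [tuple p; q; r].

Lemma tri_ind (P : 'I_3 -> Prop) :
  P (@Ordinal 3 0 isT) -> P (@Ordinal 3 1 isT) -> P (@Ordinal 3 2 isT) ->
  forall i, P i.
Proof.
by move=> h0 h1 h2 [[|[|[|//]]] hi]; rewrite (bool_irrelevance hi isT).
Qed.

Lemma tri_ratmap d p q r : (p != 0) || (r != 0) -> p \is d.-homog ->
  q \is d.-homog -> r \is d.-homog -> ratmap (tri p q r).
Proof.
move=> pr0 hp hq hr; split; first by exists d; apply: tri_ind.
case/orP: pr0 => h; first by exists (@Ordinal 3 0 isT).
by exists (@Ordinal 3 2 isT).
Qed.

Lemma tri_birational d e p q r p' q' r' (a b : {mpoly F[3]}) :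
  (p != 0) || (r != 0) -> p \is d.-homog -> q \is d.-homog -> r \is d.-homog ->
  (p' != 0) || (r' != 0) -> p' \is e.-homog -> q' \is e.-homog ->
  r' \is e.-homog -> a != 0 -> b != 0 ->
  [/\ p \mPo tri p' q' r' = a * x, q \mPo tri p' q' r' = a * y &
      r \mPo tri p' q' r' = a * z] ->
  [/\ p' \mPo tri p q r = b * x, q' \mPo tri p q r = b * y &
      r' \mPo tri p q r = b * z] ->
  birational (tri p q r).
Proof.
move=> p0 hp hq hr p'0 hp' hq' hr' a0 b0 [px qy rz] [px' qy' rz'].
apply: (@birational_scale _ _ (tri p' q' r') a b) => //.
- exact: tri_ratmap hq hr.
- exact: tri_ratmap hq' hr'.
- exact: tri_ind.
- exact: tri_ind.
Qed.

Lemma comp_x p q r : x \mPo tri p q r = p.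
Proof. by rewrite comp_mpolyXU. Qed.
Lemma comp_y p q r : y \mPo tri p q r = q.
Proof. by rewrite comp_mpolyXU. Qed.
Lemma comp_z p q r : z \mPo tri p q r = r.
Proof. by rewrite comp_mpolyXU. Qed.

Lemma homogX (i : 'I_3) : ('X_i : {mpoly F[3]}) \is 1.-homog.
Proof. by rewrite dhomogX /= mdeg1. Qed.

Definition compE := (comp_mpolyD, comp_mpolyB, comp_mpolyZ, comp_x, comp_y, comp_z).

Lemma linear_birational (a b c d a' b' c' d' : F) :
  [/\ a * a' + b * c' = 1, a * b' + b * d' = 0,
      c * a' + d * c' = 0 & c * b' + d * d' = 1] ->
  [/\ a' * a + b' * c = 1, a' * b + b' * d = 0,
      c' * a + d' * c = 0 & c' * b + d' * d = 1] ->
  birational (tri (a *: x + b *: y) (c *: x + d *: y) z).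
Proof.
have H (u v : F) : u *: x + v *: y \is [in F[3], 1.-homog].
  by rewrite rpredD // dhomogZ // homogX.
have E u v u1 v1 u2 v2 : u *: (u1 *: x + v1 *: y) + v *: (u2 *: x + v2 *: y) =
    (u * u1 + v * u2) *: x + (u * v1 + v * v2) *: y.
  by rewrite !scalerDr !scalerA addrACA -!scalerDl.
move=> [e1 e2 e3 e4] [f1 f2 f3 f4].
apply: (@tri_birational 1 1 _ _ _ (a' *: x + b' *: y) (c' *: x + d' *: y) z 1 1);
  rewrite ?mpolyXU_neq0 ?orbT ?oner_eq0 ?homogX ?H //.
- by rewrite !compE !E e1 e2 e3 e4 !scale1r !scale0r addr0 add0r !mul1r.
- by rewrite !compE !E f1 f2 f3 f4 !scale1r !scale0r addr0 add0r !mul1r.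
Qed.

Lemma SL2Z_inv_entries (A B : 'M[int]_2) (i j : 'I_2) :
  A *m B = 1%:M ->
  (A i 0)%:~R * (B 0 j)%:~R + (A i 1)%:~R * (B 1 j)%:~R = (i == j)%:R :> F.
Proof.
move=> /matrixP/(_ i j); rewrite !mxE !big_ord_recl big_ord0 addr0.
rewrite (_ : lift ord0 ord0 = 1); last exact: val_inj.
by move=> e; rewrite -!intrM -intrD e; case: eqP.
Qed.

Definition linear_triple (M : SL2Z) : triple F :=
  tri ((val M 0 0)%:~R *: x + (val M 0 1)%:~R *: y)
      ((val M 1 0)%:~R *: x + (val M 1 1)%:~R *: y) z.

Lemma linear_tripleP M : birational (linear_triple M).
Proof.
have MV := mulmxV (SL2Z_unit M); have VM := mulVmx (SL2Z_unit M).
apply: (linear_birational (a' := (invmx (val M) 0 0)%:~R)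
  (b' := (invmx (val M) 0 1)%:~R) (c' := (invmx (val M) 1 0)%:~R)
  (d' := (invmx (val M) 1 1)%:~R)); by rewrite !SL2Z_inv_entries.
Qed.

Definition theta_e (M : SL2Z) : Bir F := bir (linear_tripleP M).

Definition tau_triple (mu : F) : triple F := tri (x + mu *: y) y z.

Lemma tau_tripleP mu : birational (tau_triple mu).
Proof.
have -> : tau_triple mu = tri (1 *: x + mu *: y) (0 *: x + 1 *: y) z.
  by rewrite !scale1r scale0r add0r.
by apply: (linear_birational (a' := 1) (b' := - mu) (c' := 0) (d' := 1)); split;
  ring.
Qed.

Definition tau (mu : F) : Bir F := bir (tau_tripleP mu).

Definition psi'_triple (k : nat) : triple F :=
  tri (x ^+ k) (y * x ^+ k.-1 + z ^+ k) (z * x ^+ k.-1).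

Lemma psi'_tripleP k : (0 < k)%N -> birational (psi'_triple k).
Proof.
case: k => // k _; rewrite /psi'_triple /=.
have x0 n : x ^+ n != 0 by rewrite expf_neq0 // mpolyXU_neq0.
have hX i n : ('X_i : {mpoly F[3]}) ^+ n \is n.-homog.
  by have := dhomogMn n (homogX i); rewrite mul1n.
have hM i : 'X_i * x ^+ k \is [in F[3], (k.+1).-homog].
  by rewrite -(add1n k); apply/dhomogM/hX/homogX.
pose a := x ^+ (k + k.+1 * k).
apply: (@tri_birational k.+1 k.+1 _ _ _ (x ^+ k.+1) (y * x ^+ k - z ^+ k.+1)
  (z * x ^+ k) a a); rewrite ?x0 ?hX ?hM ?rpredD ?rpredN ?hX ?hM //.
- split; rewrite ?comp_mpolyB ?comp_mpolyD ?rmorphM ?rmorphXn /= !compE.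
  + by rewrite -exprM -exprSr; congr (_ ^+ _); lia.
  + by rewrite exprMn -!exprM mulrBl (mulnC k k.+1) subrK -mulrA -exprD mulrC.
  + by rewrite -exprM -mulrA -exprD mulrC.
- split; rewrite ?comp_mpolyB ?comp_mpolyD ?rmorphM ?rmorphXn /= !compE.
  + by rewrite -exprM -exprSr; congr (_ ^+ _); lia.
  + by rewrite exprMn -!exprM mulrDl (mulnC k k.+1) addrK -mulrA -exprD mulrC.
  + by rewrite -exprM -mulrA -exprD mulrC.
Qed.

(* k > 0 makes the triple homogeneous of degree k. *)
Definition psi' (k : nat) (k_gt0 : (0 < k)%N) : Bir F :=
  bir (psi'_tripleP k_gt0).

Definition psi (mu : F) (k : nat) (k_gt0 : (0 < k)%N) : Bir F :=
  (tau mu * psi' k_gt0 * (tau mu)^-1)%g.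

End Maps.


(* The point (mu : 1 : 0) of the line z = 0 is fixed only by the trivial element
   of PSL(2, Z), that is, by M = 1 and M = - 1 in SL(2, Z). *)
Definition trivial_isotropy (F : fieldType) (mu : F) : Prop :=
  let p : 'cV[F]_2 := \col_i (if i == 0 then mu else 1) in
  forall M : SL2Z,
    (exists2 c : F, c != 0 & map_mx intr (val M) *m p = c *: p) ->
    val M = 1%:M \/ val M = - 1%:M.

Definition hyperbolic_embedding (R : realType)
    (theta : {multiplicative SL2Z -> Bir R[i]}) : Prop :=
  injective theta /\
  forall f : Bir R[i], (exists M, theta M = f) -> infinite_order f -> hyperbolic f.

(* Main.v *)
Require Import Defs.
From mathcomp Require Import all_boot all_order all_algebra.
From mathcomp Require Import mpoly complex.
From mathcomp Require Import boolp classical_sets reals topology normedtype.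
From mathcomp Require Import sequences exp.
From mathcomp Require Import ring zify.

Set Implicit Arguments.
Unset Strict Implicit.
Unset Printing Implicit Defensive.
Import Order.TTheory GRing.Theory Num.Theory.
Import numFieldNormedType.Exports.
Local Open Scope ring_scope.

(** A composite [f o g] of plane maps has degree [deg f * deg g] as soon as [g]
    contracts no curve to a base point of [f].  Here the linear maps have no
    base point, while [psi] and its inverse have the single proper base point
    [p = (mu : 1 : 0)] and contract one line, to [p] itself.  So in a product
    of matrices of SL2(Z) alternating with powers [psi^1] and [psi^-1], the
    points of the line [z = 0] to which some curve is contracted are images of
    [p] by partial products of these matrices, and [p] itself is met only if
    such a product fixes [p].  Trivial isotropy excludes this when the partial
    products are not 1 or -1, and for alternating products of [S^(+-1)] and
    [(RS)^(+-1)] this is the statement that PSL2(Z) is a free product, which is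
    read off the signs of the entries ([admissible_mulST]).  Hence
    [theta (S^b_1 T^a_1 ... S^b_n T^a_n)], with [T = RS], has degree exactly
    [k ^ (2 n)] ([word_represents]); powers of words are words, so its
    dynamical degree is [k ^ (2 n)].

    Coprimality of polynomials is replaced by the regularity of the pair
    ([p] divides [q c] only if it divides [c]), which needs no factorization
    theory and is stable under the operations met in composing with [psi]
    ([avoids_shear]).  It yields that every triple representing the same map is
    a polynomial multiple of the given one ([avoids_primitive]), hence that the
    degree of the map is that of the triple.

    For the other two assertions, [S] and [T] generate SL2(Z) and every element
    is [S^c w S^d] with [w] a word ([SL2Z_reducible]), so that all degrees on
    the image of [theta] are known, are submultiplicative there, and are at
    least [k ^ 2] outside the powers of [S]; injectivity follows.  Up to
    conjugation, every element is a nonempty word or has order dividing 12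
    ([SL2Z_tame]), and submultiplicativity makes the dynamical degree invariant
    under conjugation. *)

(** * Regular pairs in an integral domain *)

Section RegularPairs.
Variable A : idomainType.
Implicit Types p q r c : A.

Definition divides p q := exists r, q = p * r.

(** [p, q] is a regular sequence in the weak sense; in a factorial domain this is
    coprimality. *)
Definition regular p q := p != 0 /\ forall c, divides p (q * c) -> divides p c.

(** If [q c = p d], regularity gives [d = p f], and cancelling [p] leaves
    [c = q f]. *)
Lemma regular_sym p q : q != 0 -> regular p q -> regular q p.
Proof.
move=> q0 [p0 h]; split=> // c [d e].
have [f fE] : divides p d by apply: h; exists c.
exists f; apply: (mulfI p0); rewrite e fE; ring.
Qed.

Lemma regularMr p q r : regular p q -> regular p r -> regular p (q * r).
Proof.
move=> [p0 hq] [_ hr]; split=> // c; rewrite -mulrA => /hq; exact: hr.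
Qed.

Lemma regularXr p q n : regular p q -> regular p (q ^+ n).
Proof.
move=> h; elim: n => [|n IH]; last by rewrite exprS; apply: regularMr.
by case: h => p0 _; split=> // c; rewrite expr0 mul1r.
Qed.

Lemma regularDr p q r : regular p q -> regular p (q + p * r).
Proof.
move=> [p0 h]; split=> // c [d e]; apply: h; exists (d - r * c).
by rewrite mulrBr -e; ring.
Qed.

Lemma regularMl p q r : regular p r -> regular q r -> regular (p * q) r.
Proof.
move=> [p0 hp] [q0 hq]; split; first by rewrite mulf_neq0.
move=> c [d e].
have [f fE] : divides p c by apply: hp; exists (q * d); rewrite e mulrA.
have [g gE] : divides q f.
  apply: hq; exists d; apply: (mulfI p0); rewrite mulrCA -fE e; ring.
by exists g; rewrite fE gE mulrA.
Qed.

Lemma regularXl p q n : regular p q -> regular (p ^+ n) q.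
Proof.
move=> h; elim: n => [|n IH]; last by rewrite exprS; apply: regularMl.
by split=> [|c _]; [rewrite expr0 oner_neq0|exists c; rewrite expr0 mul1r].
Qed.

End RegularPairs.

(** * Degree of a plane map and contracted curves *)

Section Maps.
Variable F : fieldType.
Local Notation P3 := {mpoly F[3]}.
Local Notation i0 := (@Ordinal 3 0 isT).
Local Notation i1 := (@Ordinal 3 1 isT).
Local Notation i2 := (@Ordinal 3 2 isT).
Local Notation x := ('X_i0 : P3).
Local Notation y := ('X_i1 : P3).
Local Notation z := ('X_i2 : P3).
Implicit Types t s : triple F.

(** Setting [z = 0] leaves unchanged the monomials without [z], and all other
    monomials are multiples of [z]. *)
Lemma divides_z (q : P3) : q \mPo tri x y 0 = 0 -> divides z q.
Proof.
move=> q0.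
suff [r rE] : divides z (q - (q \mPo tri x y 0)).
  by exists r; rewrite -rE q0 subr0.
rewrite {1}[q]mpolyE comp_mpolyEX -sumrB.
elim/big_ind: _ => [|u v [u' ->] [v' ->]|m _]; first by exists 0; rewrite mulr0.
  by exists (u' + v'); rewrite mulrDr.
rewrite comp_mpolyX -scalerBr (mpolyXE_id _ m) !big_ord_recr !big_ord0 /= !mul1r.
have [e0 e1 e2] : [/\ widen_ord (leqnSn 2) (widen_ord (leqnSn 1) ord_max) = i0,
    widen_ord (leqnSn 2) ord_max = i1 & ord_max = i2] by split; apply: val_inj.
rewrite e0 e1 e2 !(tnth_nth 0) /=.
case: (m i2) => [|n]; first by exists 0; rewrite !expr0 subrr scaler0 mulr0.
exists (q@_m *: (x ^+ m i0 * y ^+ m i1 * z ^+ n)).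
by rewrite expr0n mulr0 subr0 -scalerAr exprSr; congr (_ *: _); ring.
Qed.

(** A curve contracted by [t] to the zero of the linear form [a x + b y] on the
    line [z = 0] would be a common component of the two polynomials, so their
    regularity says that there is no such curve.  The third polynomial has to
    be a nonunit for regularity to force the other one to be nonzero. *)
Definition avoids t (a b : F) :=
  tnth t i2 \isn't a GRing.unit /\
  regular (tnth t i2) (a *: tnth t i0 + b *: tnth t i1).

Lemma linear_neq0 (a b : F) : (a, b) != (0, 0) -> a *: x + b *: y != 0.
Proof.
rewrite xpair_eqE negb_and; apply: contraTneq => /mpolyP l0; rewrite negb_or !negbK.
have := l0 U_(i0)%MM; have := l0 U_(i1)%MM.
rewrite !mcoeffD !mcoeffZ !mcoeffX !mcoeff0 !eqxx !mulr1.
by rewrite !eq_mnm1 /= !mulr0 addr0 add0r => -> ->; rewrite eqxx.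
Qed.

Lemma avoids_id (a b : F) : (a, b) != (0, 0) -> avoids (id3 F) a b.
Proof.
move=> /linear_neq0 l0; rewrite /avoids !tnth_id3; split.
  apply/negP => /unitrP[q [zq _]].
  have := congr1 (fun p : P3 => p \mPo tri x y 0) zq.
  rewrite rmorphM rmorph1 /= !Defs.compE mulr0 => /esym/eqP.
  by rewrite oner_eq0.
split=> [|c [d e]]; first exact: mpolyXU_neq0.
apply: divides_z; apply/eqP.
have /eqP : ((a *: x + b *: y) * c) \mPo tri x y 0 = 0.
  by rewrite e rmorphM /= !Defs.compE mul0r.
by rewrite rmorphM /= !Defs.compE mulf_eq0 (negbTE l0).
Qed.

(** The triples without common factor, in a form that is meaningful without
    greatest common divisors: [t] divides every triple defining the same map. *)
Definition primitive t :=
  forall s, same_map t s -> exists c, forall i, tnth s i = c * tnth t i.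

(** Write [l] for [a x + b y].  If [s] defines the same map as [t], then
    [l(t) s_2 = t_2 l(s)], so regularity gives [s_2 = c t_2]; the relations
    [t_2 s_i = t_i s_2] extend this to the other components. *)
Lemma avoids_primitive t a b : avoids t a b -> primitive t.
Proof.
set l := a *: tnth t i0 + b *: tnth t i1.
move=> [_ [w0 h]] s /same_mapP ts.
have [c cE] : divides (tnth t i2) (tnth s i2).
  apply: h; exists (a *: tnth s i0 + b *: tnth s i1).
  by rewrite mulrDr mulrDl -!scalerAl -!scalerAr !(ts i2).
by exists c => i; apply: (mulfI w0); rewrite ts cE; ring.
Qed.

(** A common factor [p] of [t] gives a triple [t / p] defining the same map; it
    is then a multiple of [t], so [p] is invertible. *)
Lemma primitive_coprime t : nonzero t -> primitive t -> coprime3 t.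
Proof.
move=> [j tj] prim p /choice [q qE].
have [|c cE] := prim [tuple q i | i < 3].
  by apply/same_mapP => a b; rewrite !tnth_mktuple !qE; ring.
have pc : c * p = 1.
  apply: (mulIf tj); have := qE j; have := cE j; rewrite tnth_mktuple => ->.
  by rewrite mul1r => {2}->; ring.
have /andP[/eqP pE _] := mpoly_intro_unit pc.
by exists p@_0.
Qed.

Lemma primitive_degree t (ht : birational t) d : primitive t ->
  (forall i, tnth t i \is d.-homog) -> degree (bir ht) = d.
Proof.
move=> prim td; have [[_ nzt] _] := ht.
rewrite /degree; apply: xget_unique => [|e [s [hs [/bir_eq ts sc se]]]].
  by exists t, ht; split=> //; apply: primitive_coprime.
have [c cE] := prim _ ts.
have [|c0 c0E] := sc c; first by move=> i; exists (tnth t i).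
have [[_ [j sj]] _] := hs.
apply: (dhomog_uniq sj (se j)).
by rewrite cE c0E mul_mpolyC dhomogZ.
Qed.

Lemma primitive_degree_le t (ht : birational t) s (hs : birational s) d e :
  primitive t -> (forall i, tnth t i \is d.-homog) ->
  (forall i, tnth s i \is e.-homog) -> bir ht = bir hs -> (d <= e)%N.
Proof.
move=> prim td se /bir_eq /prim [c cE].
have [[_ [j sj]] _] := hs.
have := sj; rewrite cE mulf_eq0 => /norP[c0 tj].
have size_homog (p : P3) n : p != 0 -> p \is n.-homog -> msize p = n.+1.
  by move=> p0 pn; rewrite (mpolySpred _ p0) (dhomog_uniq p0 (dhomog_msize pn) pn).
have := msizeM c0 tj; rewrite -cE (size_homog _ _ sj (se j)).
rewrite (size_homog _ _ tj (td j)) (mpolySpred _ c0); lia.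
Qed.

(** * Composition with linear maps and with the map psi *)

Lemma comp3_tri (p q r : P3) t :
  comp3 (tri p q r) t = tri (p \mPo t) (q \mPo t) (r \mPo t).
Proof.
by apply: eq_from_tnth; apply: tri_ind; rewrite tnth_comp3 !(tnth_nth 0).
Qed.

Lemma mPoX i t : 'X_i \mPo t = tnth t i.
Proof. by rewrite comp_mpolyXU -tnth_nth. Qed.

(** Linear maps move the points of the line [z = 0], hence act on linear forms
    from the right. *)
Lemma avoids_linear N t a b : avoids (comp3 (linear_triple F N) t) a b =
  avoids t (a * (val N 0 0)%:~R + b * (val N 1 0)%:~R)
           (a * (val N 0 1)%:~R + b * (val N 1 1)%:~R).
Proof.
rewrite /avoids /linear_triple comp3_tri !(tnth_nth 0) /=.
rewrite !(comp_mpolyD, comp_mpolyZ, mPoX) !(tnth_nth 0).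
congr (_ /\ regular _ _); rewrite !scalerDr !scalerDl !scalerA; ring.
Qed.

Lemma avoids_tau mu t a b :
  avoids (comp3 (tau_triple mu) t) a b = avoids t a (a * mu + b).
Proof.
rewrite /avoids /tau_triple comp3_tri !(tnth_nth 0) /=.
rewrite !(comp_mpolyD, comp_mpolyZ, mPoX) !(tnth_nth 0).
congr (_ /\ regular _ _); rewrite !scalerDr !scalerDl !scalerA; ring.
Qed.

(** In the chart [x = 1] this is [(y, z) |-> (y + c z ^ k, z)], whence the
    inverse is obtained by changing [c] into [- c]. *)
Definition shear_triple (c : F) (k : nat) : triple F :=
  tri (x ^+ k) (y * x ^+ k.-1 + c *: z ^+ k) (z * x ^+ k.-1).

Lemma comp3_shear c k t : comp3 (shear_triple c k) t =
  tri (tnth t i0 ^+ k) (tnth t i1 * tnth t i0 ^+ k.-1 + c *: tnth t i2 ^+ k)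
      (tnth t i2 * tnth t i0 ^+ k.-1).
Proof.
have mPoXn i n : 'X_i ^+ n \mPo t = tnth t i ^+ n.
  by rewrite (rmorphXn (comp_mpoly t)) /= mPoX.
rewrite comp3_tri comp_mpolyD comp_mpolyZ !(rmorphM (comp_mpoly t)) /=.
by rewrite !mPoXn !mPoX.
Qed.

(** With [t = (u, v, w)], the pair to be examined after composition is
    [w u^(k-1)] and [(a u + b v) u^(k-1) + b c w^k].  Modulo [w] the second
    polynomial is [(a u + b v) u^(k-1)], and modulo [u] it is [b c w^k]: the
    hypotheses on [t] handle the former, and [b != 0] with the regularity of
    [u, w] the latter.  The condition [b != 0] says that the point is not the
    base point [(0 : 1 : 0)], to which the line [x = 0] is contracted;
    [avoids t 1 0] says that [t] contracts no curve to that base point. *)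
Lemma avoids_shear (c : F) k t (a b : F) : c != 0 -> (1 < k)%N -> b != 0 ->
  avoids t 1 0 -> avoids t a b -> avoids (comp3 (shear_triple c k) t) a b.
Proof.
case: k => [|[|k]] // c0 _ b0.
rewrite /avoids comp3_shear -[k.+2.-1]/k.+1.
have tnth_tri (p q r : P3) : [/\ tnth (tri p q r) i0 = p,
    tnth (tri p q r) i1 = q & tnth (tri p q r) i2 = r].
  by split; rewrite (tnth_nth 0).
have [-> -> ->] := tnth_tri (tnth t i0 ^+ k.+2)
  (tnth t i1 * tnth t i0 ^+ k.+1 + c *: tnth t i2 ^+ k.+2)
  (tnth t i2 * tnth t i0 ^+ k.+1).
rewrite scale1r scale0r addr0.
set u := tnth t i0; set v := tnth t i1; set w := tnth t i2 => -[wU wu] [_ wl].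
split; first by apply: contra wU; rewrite unitrM => /andP[].
have [w0 hwu] := wu.
(* if u = 0 then w divides u * 1, so w divides 1 *)
have u0 : u != 0.
  apply: contraNneq wU => u0; apply/unitrP.
  have [|d dE] := hwu 1; first by exists 0; rewrite u0 mul0r mulr0.
  by exists d; rewrite [d * w]mulrC -dE.
set X := (X in regular _ X).
have XE : X = (a *: u + b *: v) * u ^+ k.+1 + w * ((b * c) *: w ^+ k.+1).
  by rewrite /X -!mul_mpolyC mpolyCM !exprS; ring.
apply: regularMl.
  by rewrite XE; apply: regularDr; apply: regularMr => //; apply: regularXr.
apply: regularXl.
have -> : X = (b * c)%:MP * w ^+ k.+2 + u * ((a *: u + b *: v) * u ^+ k).
  by rewrite XE -!mul_mpolyC mpolyCM !exprS; ring.
apply: regularDr; apply: regularMr; last by apply: regularXr; apply: regular_sym.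
split=> // e [d dE]; exists ((b * c)^-1 *: d).
by rewrite -scalerAr -dE mul_mpolyC scalerA mulVf ?scale1r // mulf_neq0.
Qed.

Lemma shear_psi' k : psi'_triple F k = shear_triple 1 k.
Proof. by rewrite /psi'_triple /shear_triple scale1r. Qed.

Lemma shear_tripleK c k : (0 < k)%N ->
  comp3 (shear_triple c k) (shear_triple (- c) k) =
  tri (x ^+ (k * k).-1 * x) (x ^+ (k * k).-1 * y) (x ^+ (k * k).-1 * z).
Proof.
case: k => // k _; rewrite comp3_shear !(tnth_nth 0 (tri _ _ _)) -[k.+1.-1]/k.
rewrite -[nth 0 _ i0]/(x ^+ k.+1) -[nth 0 _ i1]/(y * x ^+ k + - c *: z ^+ k.+1).
rewrite -[nth 0 _ i2]/(z * x ^+ k).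
have xk : x ^+ (k.+1 * k.+1).-1 = x ^+ k * (x ^+ k.+1) ^+ k.
  by rewrite -exprM -exprD; congr (_ ^+ _); lia.
have zk : (z * x ^+ k) ^+ k.+1 = z ^+ k.+1 * (x ^+ k.+1) ^+ k.
  by rewrite exprMn -!exprM mulnC.
rewrite xk zk; congr (tri _ _ _); rewrite -?mul_mpolyC ?mpolyCN ?[_ ^+ k.+1]exprS; ring.
Qed.

Lemma shear_homog c k i : (0 < k)%N -> tnth (shear_triple c k) i \is k.-homog.
Proof.
case: k => // k _; move: i; rewrite /shear_triple.
have hX i n : ('X_i : P3) ^+ n \is n.-homog.
  by have := dhomogMn n (homogX F i); rewrite mul1n.
have hM i : 'X_i * x ^+ k \is [in F[3], (k.+1).-homog].
  by rewrite -(add1n k); apply/dhomogM/hX/homogX.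
by apply: tri_ind; rewrite (tnth_nth 0) /= ?rpredD ?dhomogZ ?hX ?hM.
Qed.

(** Relates an element of the Cremona group to an explicit triple, which may
    have common factors. *)
Definition represents (f : Bir F) t := exists ht : birational t, f = bir ht.

Lemma representsM f g t s :
  represents f t -> represents g s -> represents (f * g)%g (comp3 t s).
Proof.
move=> [ht ->] [hs ->]; exists (comp3_birational ht hs); exact: birME.
Qed.

Lemma represents_inv f g t s : represents f t -> represents g s ->
  same_map (comp3 t s) (id3 F) -> (f^-1)%g = g.
Proof.
move=> [ht ->] [hs ->] ts; apply: mulg1_eq.
by rewrite [LHS]birME; apply/bir_eq.
Qed.

Lemma same_map_scaled_id (w : P3) :
  same_map (tri (w * x) (w * y) (w * z)) (id3 F).
Proof.
apply: (@scaled_same_map _ 1 w); first exact: oner_neq0.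
by apply: tri_ind; rewrite tnth_id3 mul1r (tnth_nth 0).
Qed.

Lemma shear_birational c k : (0 < k)%N -> birational (shear_triple c k).
Proof.
move=> k_gt0.
have rat e : ratmap (shear_triple e k).
  split; first by exists k => i; apply: shear_homog.
  by exists i0; rewrite (tnth_nth 0) expf_neq0 // mpolyXU_neq0.
have inv e : inverse3 (shear_triple e k) (shear_triple (- e) k).
  rewrite /inverse3 shear_tripleK //; split; last exact: same_map_scaled_id.
  by exists i0; rewrite (tnth_nth 0) mulf_neq0 ?expf_neq0 // mpolyXU_neq0.
split=> //; exists (shear_triple (- c) k); split=> //.
by rewrite -{2}[c]opprK; apply: inv.
Qed.

Lemma represents_psi' k (k_gt0 : (0 < k)%N) :
  represents (psi' F k_gt0) (shear_triple 1 k).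
Proof.
exists (shear_birational 1 k_gt0); apply/bir_eq.
by rewrite shear_psi' same_map_refl.
Qed.

Lemma represents_psi'V k (k_gt0 : (0 < k)%N) :
  represents (psi' F k_gt0)^-1%g (shear_triple (- 1) k).
Proof.
have r : represents (bir (shear_birational (- 1) k_gt0)) (shear_triple (- 1) k).
  by exists (shear_birational (- 1) k_gt0).
rewrite (represents_inv (represents_psi' k_gt0) r) //.
by rewrite shear_tripleK // same_map_scaled_id.
Qed.

Lemma represents_tauV mu : represents (tau mu)^-1%g (tau_triple (- mu)).
Proof.
have r nu : represents (tau nu) (tau_triple nu) by exists (tau_tripleP nu).
rewrite (represents_inv (r mu) (r (- mu))) //.
rewrite /tau_triple comp3_tri comp_mpolyD comp_mpolyZ !mPoX !(tnth_nth 0) /=.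
have -> : x + - mu *: y + mu *: y = x by rewrite scaleNr subrK.
by have := same_map_scaled_id 1; rewrite !mul1r.
Qed.

Lemma theta_eM M N : theta_e F (M * N)%g = (theta_e F M * theta_e F N)%g.
Proof.
rewrite [RHS]birME; apply/bir_eq.
rewrite /linear_triple comp3_tri !comp_mpolyD !comp_mpolyZ !mPoX !(tnth_nth 0) /=.
have E i j : (val (M * N)%g i j)%:~R =
    (val M i 0)%:~R * (val N 0 j)%:~R + (val M i 1)%:~R * (val N 1 j)%:~R :> F.
  rewrite mxE !big_ord_recl big_ord0 addr0 intrD !intrM.
  by rewrite (_ : lift ord0 ord0 = 1) //; apply: val_inj.
rewrite !E !scalerDr !scalerDl !scalerA.
set t := (X in same_map X _); set s := (X in same_map _ X).
have -> : t = s by rewrite /t /s; congr (tri _ _ _); ring.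
exact: same_map_refl.
Qed.

Lemma theta_e1 : theta_e F 1%g = 1%g.
Proof. by apply: (@mulgI _ (theta_e F 1%g)); rewrite -theta_eM !mulg1. Qed.

Lemma theta_eV M : theta_e F (M^-1)%g = (theta_e F M)^-1%g.
Proof. by apply/esym/mulg1_eq; rewrite -theta_eM mulgV theta_e1. Qed.

End Maps.

(** * Signs of the entries of alternating products in SL2(Z) *)

Section Modular.

Lemma SL2Z_mulE (M N : SL2Z) i j : val (M * N)%g i j =
  val M i 0 * val N 0 j + val M i 1 * val N 1 j.
Proof.
rewrite mxE !big_ord_recl big_ord0 addr0.
by rewrite (_ : lift ord0 ord0 = 1) //; apply: val_inj.
Qed.

Lemma ord2_ind (P : 'I_2 -> Prop) : P 0 -> P 1 -> forall i, P i.
Proof.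
move=> h0 h1 [[|[|//]] hi].
  by rewrite (_ : Ordinal hi = 0) //; apply: val_inj.
by rewrite (_ : Ordinal hi = 1) //; apply: val_inj.
Qed.

Lemma SL2Z_ext (M N : SL2Z) : val M 0 0 = val N 0 0 -> val M 0 1 = val N 0 1 ->
  val M 1 0 = val N 1 0 -> val M 1 1 = val N 1 1 -> M = N.
Proof.
move=> h00 h01 h10 h11; apply: val_inj; apply/matrixP.
by apply: ord2_ind; apply: ord2_ind.
Qed.

Lemma SL2Z_detE (M : SL2Z) :
  val M 0 0 * val M 1 1 - val M 0 1 * val M 1 0 = 1.
Proof.
rewrite -[RHS](SL2Z_det M) -det_mx2; congr (\det _).
by apply/matrixP; apply: ord2_ind; apply: ord2_ind; rewrite mxE.
Qed.

Definition matT : SL2Z := (matR * matS)%g.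

Lemma matTE : val matT = mx2 (-1) 1 (-1) 0.
Proof.
by apply/matrixP; apply: ord2_ind; apply: ord2_ind; rewrite SL2Z_mulE !mxE.
Qed.

Lemma matSVE : val (matS^-1)%g = mx2 0 (-1) 1 0.
Proof.
have h : \det (mx2 0 (-1) 1 0) == 1 by rewrite det_mx2.
pose N : SL2Z := exist _ (mx2 0 (-1) 1 0) h.
rewrite (@mulg1_eq _ matS N) //.
by apply: SL2Z_ext; rewrite SL2Z_mulE !mxE.
Qed.

Lemma matTVE : val (matT^-1)%g = mx2 0 (-1) 1 (-1).
Proof.
have h : \det (mx2 0 (-1) 1 (-1)) == 1 by rewrite det_mx2.
pose N : SL2Z := exist _ (mx2 0 (-1) 1 (-1)) h.
rewrite (@mulg1_eq _ matT N) //.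
by apply: SL2Z_ext; rewrite SL2Z_mulE matTE !mxE.
Qed.

Definition signed (G : groupType) (g : G) (b : bool) : G :=
  if b then g else (g^-1)%g.

(** The entry [(b, a)] of the list stands for [S^b T^a], a sign being positive
    when the boolean is [true]. *)
Definition word (G : groupType) (S T : G) (s : seq (bool * bool)) : G :=
  (\prod_(ba <- s) (signed S ba.1 * signed T ba.2))%g.

Lemma signedSE b : val (signed matS b) =
  if b then mx2 0 1 (-1) 0 else mx2 0 (-1) 1 0.
Proof. by case: b; rewrite /signed ?matSVE. Qed.

Lemma signedTE a : val (signed matT a) =
  if a then mx2 (-1) 1 (-1) 0 else mx2 0 (-1) 1 (-1).
Proof. by case: a; rewrite /signed ?matTVE ?matTE. Qed.

(** The set of matrices obtained from 1 and [T^(+-1)] by right multiplication by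
    [S^(+-1) T^(+-1)] is contained in the set below, which is stable under these
    multiplications: up to sign they subtract one column from the other, so that
    the entries of each row keep opposite signs.  The last
    condition excludes [S] and its inverse. *)
Definition admissible (M : SL2Z) :=
  [/\ val M 0 0 * val M 0 1 <= 0, val M 1 0 * val M 1 1 <= 0
    & (val M 0 0 != 0) || (val M 1 1 != 0)].

(** For a matrix of determinant 1, to be 1 or -1. *)
Definition central (M : SL2Z) :=
  [&& val M 0 0 == val M 1 1, val M 0 1 == 0 & val M 1 0 == 0].

Lemma admissible1 : admissible 1%g.
Proof. by split; rewrite !mxE. Qed.

Lemma admissibleT a : admissible (signed matT a).
Proof. by rewrite /admissible signedTE; case: a; split; rewrite !mxE. Qed.

Lemma centralT a : ~~ central (signed matT a).
Proof. by rewrite /central signedTE; case: a; rewrite !mxE. Qed.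

Lemma admissible_mulS M b : admissible M -> ~~ central (M * signed matS b)%g.
Proof.
move=> [h1 h2 h3]; have := SL2Z_detE M.
rewrite /central !SL2Z_mulE signedSE; move: h1 h2 h3.
move: (val M 0 0) (val M 0 1) (val M 1 0) (val M 1 1) => p q r s.
case: b; rewrite !mxE /=; lia.
Qed.

(** With [centralT] and [admissible_mulS], this is the part of the free product
    decomposition of PSL2(Z) that the degree computation rests on. *)
Lemma admissible_mulST M b a : admissible M ->
  admissible (M * signed matS b * signed matT a)%g /\
  ~~ central (M * signed matS b * signed matT a)%g.
Proof.
move=> [h1 h2 h3]; have := SL2Z_detE M.
rewrite /admissible /central !SL2Z_mulE signedSE signedTE.
move: h1 h2 h3.
move: (val M 0 0) (val M 0 1) (val M 1 0) (val M 1 1) => p q r s.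
have sq (n : int) : 0 <= n * n by rewrite -expr2 sqr_ge0.
move=> pq rs ps det; have := (sq p, sq q, sq r, sq s) => -[[[p2 q2] r2] s2].
(* a row (p, p) would have p * p <= 0, hence be zero *)
have pq_neq : p != q by apply: contraTneq ps => pqE; nia.
have rs_neq : r != s by apply: contraTneq ps => rsE; nia.
case: a b => [] []; rewrite !mxE /=; (split; [split|]); nia.
Qed.

End Modular.

Lemma invg_conj (G : groupType) (p g : G) :
  ((p * g * p^-1)^-1 = p * g^-1 * p^-1)%g.
Proof. by rewrite !invgM invgK mulgA. Qed.

Lemma expg_conj (G : groupType) (p g : G) n :
  ((p * g * p^-1) ^+ n = p * g ^+ n * p^-1)%g.
Proof.
elim: n => [|n IH]; first by rewrite !expg0 mulg1 mulgV.
by rewrite !expgS IH !mulgA mulgVK.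
Qed.

Lemma mulg_conjA (G : groupType) (p g h : G) :
  (p * g * p^-1 * h = p * (g * (p^-1 * h)))%g.
Proof. by rewrite !mulgA. Qed.

Section MultiplicativeGroups.
Variables (G H : groupType) (f : {multiplicative G -> H}).

Lemma multiplicative1 : f 1%g = 1%g.
Proof. by apply: (@mulgI _ (f 1%g)); rewrite -gmulfM !mulg1. Qed.

Lemma multiplicativeV g : f (g^-1)%g = (f g)^-1%g.
Proof. by apply/esym/mulg1_eq; rewrite -gmulfM mulgV multiplicative1. Qed.

Lemma multiplicativeX g n : f (g ^+ n)%g = (f g ^+ n)%g.
Proof.
by elim: n => [|n IH]; rewrite ?multiplicative1 // !expgS gmulfM IH.
Qed.

End MultiplicativeGroups.

(** * Degree of the image of a word *)

Section Words.
Variables (F : fieldType) (mu : F) (k : nat) (k_gt0 : (0 < k)%N).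
Hypotheses (k_gt1 : (1 < k)%N) (mu_isotropy : trivial_isotropy mu).
Implicit Types (t : triple F) (M N : SL2Z).

(** The coefficients of the linear form [l M], where [l = x - mu y] vanishes at
    the base point [p]; its zero is [M^-1 p]. *)
Definition lcoef1 M : F := (val M 0 0)%:~R - mu * (val M 1 0)%:~R.
Definition lcoef2 M : F := (val M 0 1)%:~R - mu * (val M 1 1)%:~R.

Lemma detF M : (val M 0 0)%:~R * (val M 1 1)%:~R -
  (val M 0 1)%:~R * (val M 1 0)%:~R = 1 :> F.
Proof. by rewrite -!intrM -intrB SL2Z_detE. Qed.

Lemma lcoef_neq0 M : (lcoef1 M, lcoef2 M) != (0, 0).
Proof.
apply/eqP => -[/eqP l1 /eqP l2]; have /eqP := oner_neq0 F; apply.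
rewrite -(detF M); move: l1 l2; rewrite !subr_eq0 => /eqP -> /eqP ->; ring.
Qed.

(** The value of [l M] at [p] vanishes only if [M] fixes [p], that is, only for
    [M] equal to 1 or -1 by trivial isotropy. *)
Lemma lcoef_base_neq0 M : ~~ central M -> lcoef1 M * mu + lcoef2 M != 0.
Proof.
move=> Mc; apply: contra Mc; rewrite /lcoef1 /lcoef2 => /eqP e.
set p := (val M 0 0)%:~R in e; set q := (val M 0 1)%:~R in e.
set r := (val M 1 0)%:~R in e; set s := (val M 1 1)%:~R in e.
(* M (mu, 1) = c (mu, 1) if the value is zero *)
pose c := r * mu + s.
have pq : p * mu + q = c * mu by apply/eqP; rewrite -subr_eq0 -e /c; apply/eqP; ring.
have c0 : c != 0.
  apply/eqP => c0; have /eqP := oner_neq0 F; apply.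
  rewrite -(detF M) -/p -/q -/r -/s.
  have -> : p * s - q * r = p * c - r * (p * mu + q) by rewrite /c; ring.
  by rewrite pq c0; ring.
suff [hM | hM] : val M = 1%:M \/ val M = - 1%:M by rewrite /central hM !mxE.
apply: mu_isotropy; exists c => //.
apply/matrixP => i j; rewrite !mxE big_ord_recl big_ord_recl big_ord0.
rewrite (_ : lift ord0 ord0 = 1); last exact: val_inj.
rewrite !mxE /= addr0 mulr1; move: i; apply: ord2_ind => /=.
  exact: pq.
by rewrite mulr1.
Qed.

(** The composite of [psi] (for [c = 1]) or of its inverse (for [c = - 1])
    with [t]. *)
Definition psi_triple (c : F) t : triple F :=
  comp3 (tau_triple mu) (comp3 (shear_triple c k) (comp3 (tau_triple (- mu)) t)).

(** Transport of [avoids_shear] by [tau], which maps [(0 : 1 : 0)] to [p]: the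
    only new point to which a curve is contracted is [p], and the hypothesis on
    [M] says that [M^-1 p] is different. *)
Lemma avoids_psi c t M : c != 0 -> ~~ central M ->
  avoids t (lcoef1 1%g) (lcoef2 1%g) -> avoids t (lcoef1 M) (lcoef2 M) ->
  avoids (psi_triple c t) (lcoef1 M) (lcoef2 M).
Proof.
move=> c0 Mc t1 tM; rewrite avoids_tau; apply: avoids_shear => //.
- exact: lcoef_base_neq0.
- rewrite avoids_tau; move: t1; rewrite /lcoef1 /lcoef2 !mxE /=.
  by rewrite mulr0 subr0 mulr1 mul1r sub0r addr0.
- rewrite avoids_tau.
  by rewrite (_ : _ + _ = lcoef2 M) //; ring.
Qed.

Lemma avoids_lcoef_linear N t M :
  avoids (comp3 (linear_triple F N) t) (lcoef1 M) (lcoef2 M) =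
  avoids t (lcoef1 (M * N)%g) (lcoef2 (M * N)%g).
Proof.
rewrite avoids_linear; rewrite /lcoef1 /lcoef2 !SL2Z_mulE !intrD !intrM.
by congr (avoids t _ _); ring.
Qed.

Lemma psi_triple_homog c t d : (forall i, tnth t i \is d.-homog) ->
  forall i, tnth (psi_triple c t) i \is (d * k).-homog.
Proof.
move=> td.
have tau_homog nu i : tnth (tau_triple nu) i \is 1.-homog.
  move: i; apply: tri_ind; rewrite (tnth_nth 0) /= ?homogX //.
  by rewrite rpredD ?dhomogZ ?homogX.
rewrite -[(d * k)%N]muln1; apply: comp3_homog => //.
apply: comp3_homog => [i|]; first exact: shear_homog.
by rewrite -[d]muln1; apply: comp3_homog.
Qed.

Lemma linear_triple_homog N i : tnth (linear_triple F N) i \is 1.-homog.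
Proof.
move: i; apply: tri_ind; rewrite (tnth_nth 0) /= ?homogX //.
  by rewrite rpredD ?dhomogZ ?homogX.
by rewrite rpredD ?dhomogZ ?homogX.
Qed.

Lemma comp3_linear_homog N t d : (forall i, tnth t i \is d.-homog) ->
  forall i, tnth (comp3 (linear_triple F N) t) i \is d.-homog.
Proof.
by move=> td; rewrite -[d]muln1; apply: comp3_homog => // i; apply: linear_triple_homog.
Qed.

Lemma represents_psi f t : represents f t ->
  represents (psi mu k_gt0 * f)%g (psi_triple 1 t).
Proof.
move=> ft; rewrite /psi -!mulgA; apply: representsM; first by exists (tau_tripleP mu).
apply: representsM; first exact: represents_psi'.
exact: representsM (represents_tauV mu) ft.
Qed.

Lemma represents_psiV f t : represents f t ->
  represents ((psi mu k_gt0)^-1 * f)%g (psi_triple (- 1) t).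
Proof.
move=> ft; rewrite /psi !invgM invgK -!mulgA.
apply: representsM; first by exists (tau_tripleP mu).
apply: representsM; first exact: represents_psi'V.
exact: representsM (represents_tauV mu) ft.
Qed.

Lemma represents_theta_e N f t : represents f t ->
  represents (theta_e F N * f)%g (comp3 (linear_triple F N) t).
Proof. by apply: representsM; exists (linear_tripleP F N). Qed.

Variable theta : {multiplicative SL2Z -> Bir F}.
Hypothesis theta_S : theta matS = theta_e F matS.
Hypothesis theta_RS : theta matT =
  (psi mu k_gt0 * theta_e F matT * (psi mu k_gt0)^-1)%g.

Lemma theta_signedS b : theta (signed matS b) = theta_e F (signed matS b).
Proof. by case: b; rewrite /signed // multiplicativeV theta_S theta_eV. Qed.

Lemma theta_signedT a : theta (signed matT a) =
  (psi mu k_gt0 * theta_e F (signed matT a) * (psi mu k_gt0)^-1)%g.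
Proof.
case: a; rewrite /signed; first exact: theta_RS.
by rewrite multiplicativeV theta_RS theta_eV; apply: invg_conj.
Qed.

(** By induction on the word, no curve is contracted to [M^-1 p] for [M]
    admissible.  Left composition by [S^b psi T^a psi^-1] requires this property
    of the shorter word at [1], [T^a] and [M S^b T^a], all admissible, and the
    matrices [T^a], [M S^b] and [M S^b T^a] not to be central. *)
Lemma word_represents s N : theta N = theta_e F N -> exists t,
  [/\ represents (theta (word matS matT s * N)%g) t,
      forall i, tnth t i \is (k ^ (2 * size s)).-homog
    & forall M, admissible M -> avoids t (lcoef1 M) (lcoef2 M)].
Proof.
move=> thN; elim: s => [|[b a] s [t [st td tM]]].
  exists (linear_triple F N); rewrite /word big_nil mul1g thN; split.
  - by exists (linear_tripleP F N).
  - exact: linear_triple_homog.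
  - move=> M _; rewrite -[linear_triple F N]comp3f1 avoids_lcoef_linear.
    exact/avoids_id/lcoef_neq0.
exists (comp3 (linear_triple F (signed matS b)) (psi_triple 1
  (comp3 (linear_triple F (signed matT a)) (psi_triple (- 1) t)))); split.
- have -> : (word matS matT ((b, a) :: s) * N =
      signed matS b * (signed matT a * (word matS matT s * N)))%g.
    by rewrite /word big_cons !mulgA.
  rewrite gmulfM [theta (signed matT a * _)%g]gmulfM theta_signedS theta_signedT.
  apply: represents_theta_e; have -> := mulg_conjA (psi mu k_gt0).
  by apply: represents_psi; apply: represents_theta_e; apply: represents_psiV.
- apply: comp3_linear_homog.
  rewrite mulnS expnD [(k ^ 2 * _)%N]mulnC expnS mulnA.
  by apply/psi_triple_homog/comp3_linear_homog/psi_triple_homog.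
have N10 : - 1 != 0 :> F by rewrite oppr_eq0 oner_eq0.
have hT : avoids (comp3 (linear_triple F (signed matT a)) (psi_triple (- 1) t))
    (lcoef1 1%g) (lcoef2 1%g).
  rewrite avoids_lcoef_linear mul1g; apply: avoids_psi => //.
  - exact: centralT.
  - exact/tM/admissible1.
  - exact/tM/admissibleT.
move=> M admM; rewrite avoids_lcoef_linear.
have [admM' cM'] := admissible_mulST b a admM.
apply: avoids_psi => //; first exact: oner_neq0.
  exact: admissible_mulS.
rewrite avoids_lcoef_linear; apply: avoids_psi => //; last exact: tM.
exact/tM/admissible1.
Qed.

End Words.

(** * Words in a group with S^4 = T^3 = 1 and S^2 commuting with T *)

Section NormalForm.
Variables (G : groupType) (S T : G).
Hypotheses (S4 : (S ^+ 4 = 1)%g) (T3 : (T ^+ 3 = 1)%g).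
Hypothesis S2T : (S ^+ 2 * T = T * S ^+ 2)%g.
Local Open Scope group_scope.
Local Notation W := (word S T).
Local Notation Z := (S ^+ 2).

Lemma word_cons b a s : W ((b, a) :: s) = signed S b * (signed T a * W s).
Proof. by rewrite /word big_cons mulgA. Qed.

Lemma word_rcons b a s : W (rcons s (b, a)) = W s * (signed S b * signed T a).
Proof. by rewrite -cats1 /word big_cat /= big_seq1. Qed.

Lemma word_nil : W [::] = 1. Proof. by rewrite /word big_nil. Qed.

Lemma word_cat s1 s2 : W (s1 ++ s2) = W s1 * W s2.
Proof. by rewrite /word big_cat. Qed.

Lemma word_exp s n : exists2 s', size s' = (n * size s)%N & W s ^+ n = W s'.
Proof.
elim: n => [|n [s' ss' IH]]; first by exists [::]; rewrite ?word_nil.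
by exists (s ++ s'); rewrite ?size_cat ?ss' // expgS IH word_cat.
Qed.

Lemma SV : S^-1 = S ^+ 3.
Proof. by apply: mulg1_eq; rewrite -expgS. Qed.

Lemma TV : T^-1 = T * T.
Proof. by apply: mulg1_eq; rewrite -T3. Qed.

Lemma signedS_exp b : signed S b = S ^+ (if b then 1 else 3)%N.
Proof. by case: b => //; rewrite /signed SV. Qed.

Lemma commuteZT a : commute Z (signed T a).
Proof. by case: a => //; apply: commuteV. Qed.

Lemma expS_even n : ~~ odd n -> S ^+ n = 1 \/ S ^+ n = Z.
Proof.
move=> n_even; rewrite -[n]odd_double_half (negbTE n_even) add0n.
elim: n./2 => [|m [IH|IH]]; first by left.
  by right; rewrite doubleS -addn2 expgnDr IH mul1g.
by left; rewrite doubleS -addn2 expgnDr IH -expgnDr.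
Qed.

Lemma expS_even_commute n g : ~~ odd n -> commute Z g -> commute (S ^+ n) g.
Proof.
by move=> /expS_even[]-> // _; apply/commute_sym/commute1.
Qed.

(** [S^2] exchanges [S] and [S^-1]. *)
Lemma absorb_even n b a s : ~~ odd n ->
  exists b', S ^+ n * W ((b, a) :: s) = W ((b', a) :: s).
Proof.
move=> /expS_even[]->; first by exists b; rewrite mul1g.
exists (~~ b); rewrite !word_cons mulgA; congr (_ * _).
rewrite !signedS_exp -expgnDr; case: b => //=.
by rewrite (expgnDr S 1%N 4) S4 mulg1.
Qed.

Lemma signedTM a : signed T a * signed T a = signed T (~~ a).
Proof.
case: a; rewrite /signed /= ?TV //.
by rewrite -mulgA -[T * (T * T)]/(T ^+ 3) T3 mulg1.
Qed.

Lemma signedT_inv a : signed T a * signed T (~~ a) = 1.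
Proof. by case: a; rewrite /signed /= ?mulgV ?mulVg. Qed.

Definition reducible_form M := exists c s d, M = S ^+ c * W s * S ^+ d.

Lemma reducible_form1 : reducible_form 1.
Proof. by exists 0%N, [::], 0%N; rewrite word_nil !mulg1. Qed.

Lemma reducible_formS M : reducible_form M -> reducible_form (S * M).
Proof. by move=> [c [s [d ->]]]; exists c.+1, s, d; rewrite expgS !mulgA. Qed.

(** If the power of [S] on the left is even, it commutes with [T], and
    [T = S^3 S T] makes the word longer.  If it is odd, it makes the first letter
    [S^(+-1)] of the word an even power, so that [T] meets the first [T^a]: they
    cancel, or make [T^2 = T^-1]. *)
Lemma reducible_formT M : reducible_form M -> reducible_form (T * M).
Proof.
move=> [c [s [d ->]]].
have Tword a t : signed T a * W t = S ^+ 3 * W ((true, a) :: t).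
  by rewrite word_cons signedS_exp mulgA -expgnDr S4 mul1g.
have -> : T = signed T true by [].
case: (boolP (odd c)) => c_odd; last first.
  have e : commute (S ^+ c) (signed T true).
    exact: expS_even_commute (commuteZT true).
  exists (c + 3)%N, ((true, true) :: s), d.
  by rewrite !mulgA -e -[_ * _ * W s]mulgA Tword expgnDr !mulgA.
case: s => [|[b a] s].
  exists 3, [:: (true, true)], (c + d)%N.
  by rewrite -Tword word_nil !mulg1 expgnDr mulgA.
pose n := (c + if b then 1 else 3)%N.
have n_even : ~~ odd n by rewrite oddD c_odd; case: b {n}.
have e : commute (S ^+ n) (signed T true).
  exact: expS_even_commute (commuteZT true).
have -> : signed T true * (S ^+ c * W ((b, a) :: s) * S ^+ d) =
    S ^+ n * (signed T true * signed T a * W s) * S ^+ d.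
  by rewrite word_cons signedS_exp !mulgA e expgnDr !mulgA.
clearbody n; case: a.
  exists (n + 3)%N, ((true, false) :: s), d.
  by rewrite signedTM -[~~ true]/false Tword expgnDr !mulgA.
by exists n, s, d; rewrite (signedT_inv true) mul1g.
Qed.

(** The two conjugacy types in SL2(Z): an element of finite order has order
    dividing 12, and an element of infinite order is conjugate to a word. *)
Definition tame M := M ^+ 12 = 1 \/
  exists s g, s != [::] /\ M = g * W s * g^-1.

Lemma tame_conj g M : tame (g * M * g^-1) -> tame M.
Proof.
have e : M = g^-1 * (g * M * g^-1) * g by rewrite !mulgA mulVg mul1g mulgVK.
case=> [|[s [h [s0 hE]]]].
  rewrite expg_conj => e1; left.
  by apply: (mulgI g); apply: (mulIg g^-1); rewrite e1 mulg1 mulgV.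
by right; exists s, (g^-1 * h); split=> //; rewrite e hE !invgM invgK !mulgA.
Qed.

(** An even power of [S] in front of a nonempty word is absorbed by its first
    letter.  An odd one makes this letter an even power of [S], so that the first
    [T^a] can be moved cyclically to the last [T^a']: they cancel, or make
    [T^(-a)], and the word is shorter in both cases. *)
Lemma tame_form c s : tame (S ^+ c * W s).
Proof.
have S12 n : (S ^+ n) ^+ 12 = 1.
  by rewrite expgnAC -[12%N]/(4 * 3)%N expgnA S4 !expg1n.
elim: {s}(size s) {-2}s (leqnn (size s)) c => [|n IH] s sn c.
  by move: sn; rewrite leqn0 size_eq0 => /eqP ->; left; rewrite word_nil mulg1.
case: s sn => [|[b a] s] sn; first by left; rewrite word_nil mulg1.
case: (boolP (odd c)) => c_odd; last first.
  have [b' ->] := absorb_even b a s c_odd.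
  by right; exists ((b', a) :: s), 1; rewrite mul1g invg1 mulg1.
pose m := (c + if b then 1 else 3)%N.
have m_even : ~~ odd m by rewrite oddD c_odd; case: b {m sn}.
have -> : S ^+ c * W ((b, a) :: s) = S ^+ m * (signed T a * W s).
  by rewrite word_cons signedS_exp !mulgA -expgnDr.
clearbody m; case/lastP: s sn => [|s [b' a']] sn.
  left; rewrite word_nil mulg1 expgMn; last first.
    exact: expS_even_commute (commuteZT a).
  rewrite S12 mul1g -[12%N]/(3 * 4)%N expgnA.
  by case: a {sn}; rewrite /signed ?expVgn T3 expg1n ?invg1.
apply: (@tame_conj (signed T a')).
have e' : commute (S ^+ m) (signed T a').
  exact: expS_even_commute (commuteZT a').
have -> : signed T a' * (S ^+ m * (signed T a * W (rcons s (b', a')))) *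
    (signed T a')^-1 = S ^+ m * (signed T a' * signed T a) * W s * signed S b'.
  by rewrite word_rcons !mulgA -e' mulgK.
have size_s : (size s <= n)%N by move: sn; rewrite /= size_rcons; lia.
case: (eqVneq a' a) => [->|aa'].
  apply: (@tame_conj (signed T (~~ a))^-1).
  rewrite signedTM.
  have e : commute (S ^+ m) (signed T (~~ a)).
    exact: expS_even_commute (commuteZT _).
  have -> : (signed T (~~ a))^-1 * (S ^+ m * signed T (~~ a) * W s * signed S b') *
      (signed T (~~ a))^-1^-1 = S ^+ m * W (rcons s (b', ~~ a)).
    by rewrite word_rcons invgK e !mulgA mulVg mul1g.
  by apply: IH; rewrite size_rcons; move: sn; rewrite /= size_rcons; lia.
have -> : signed T a' * signed T a = 1.
  by rewrite -(signedT_inv a'); congr (_ * signed T _); case: a a' aa' {sn e'} => [] [].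
rewrite mulg1 signedS_exp; move: (if b' then _ else _) => d.
apply: (@tame_conj (S ^+ d)).
have -> : S ^+ d * (S ^+ m * W s * S ^+ d) * (S ^+ d)^-1 = S ^+ (d + m) * W s.
  by rewrite expgnDr !mulgA mulgK.
by apply: IH.
Qed.

End NormalForm.

(** * Generation and conjugacy in SL2(Z) *)

Section Generation.

Lemma matS4 : (matS ^+ 4 = 1 :> SL2Z)%g.
Proof.
have -> : (matS ^+ 4 = matS * (matS * (matS * matS)))%g by [].
by apply: SL2Z_ext; rewrite !SL2Z_mulE !mxE.
Qed.

Lemma matT3 : (matT ^+ 3 = 1 :> SL2Z)%g.
Proof.
have -> : (matT ^+ 3 = matT * (matT * matT))%g by [].
by apply: SL2Z_ext; rewrite !SL2Z_mulE !mxE.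
Qed.

Lemma matS2E (M : SL2Z) i j : val (matS * (matS * M))%g i j = - val M i j.
Proof.
move: i j; apply: ord2_ind; apply: ord2_ind; rewrite !SL2Z_mulE !mxE /=; ring.
Qed.

Lemma matS2T : (matS ^+ 2 * matT = matT * matS ^+ 2)%g.
Proof.
have -> : (matS ^+ 2 = matS * matS)%g by [].
by apply: SL2Z_ext; rewrite !SL2Z_mulE !mxE.
Qed.

Lemma intz_mul_eq1 (a d : int) :
  a * d = 1 -> (a = 1 /\ d = 1) \/ (a = - 1 /\ d = - 1).
Proof.
have [->|[->|[->|[a2|a2]]]] : a = 0 \/ a = 1 \/ a = - 1 \/ 2 <= a \/ a <= - 2 by lia.
- lia.
- lia.
- lia.
- have [d1|d0] : 1 <= d \/ d <= 0 by lia.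
  + nia.
  + nia.
- have [d1|d0] : d <= - 1 \/ 0 <= d by lia.
  + nia.
  + nia.
Qed.

(** Euclid's algorithm on the first column: [R] and its inverse add or subtract
    the lower entry, and [S] exchanges both entries up to sign.  When the lower
    entry is zero, the same row operations reduce the upper right entry. *)
Lemma SL2Z_generated (P : SL2Z -> Prop) : P 1%g ->
  (forall M, P M -> P (matS * M)%g) -> (forall M, P M -> P (matT * M)%g) ->
  forall M, P M.
Proof.
move=> P1 PS PT.
have PSV M : P M -> P (matS^-1 * M)%g.
  move=> PM; have -> : (matS^-1 = matS * (matS * matS))%g by rewrite (SV matS4).
  by rewrite -!mulgA; apply/PS/PS/PS.
have PTV M : P M -> P (matT^-1 * M)%g.
  move=> PM; have -> : (matT^-1 = matT * matT)%g by rewrite (TV matT3).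
  by rewrite -mulgA; apply/PT/PT.
have PR M : P M -> P (matR * M)%g.
  by move=> PM; rewrite -[matR](mulgK matS) -/matT -mulgA; apply/PT/PSV.
have PRV M : P M -> P (matR^-1 * M)%g.
  move=> PM; have -> : (matR^-1 = matS * matT^-1)%g by rewrite invgM mulVKg.
  by rewrite -mulgA; apply/PS/PTV.
have RE (M : SL2Z) : [/\ val (matR * M)%g 0 0 = val M 0 0 + val M 1 0,
    val (matR * M)%g 0 1 = val M 0 1 + val M 1 1,
    val (matR * M)%g 1 0 = val M 1 0 & val (matR * M)%g 1 1 = val M 1 1].
  by split; rewrite !SL2Z_mulE !mxE /=; ring.
have RVE (M : SL2Z) : [/\ val (matR^-1 * M)%g 0 0 = val M 0 0 - val M 1 0,
    val (matR^-1 * M)%g 0 1 = val M 0 1 - val M 1 1,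
    val (matR^-1 * M)%g 1 0 = val M 1 0 & val (matR^-1 * M)%g 1 1 = val M 1 1].
  have := RE (matR^-1 * M)%g; rewrite mulVKg => -[-> -> -> ->].
  by rewrite !addrK.
have SE (M : SL2Z) : val (matS * M)%g 0 0 = val M 1 0 /\
    val (matS * M)%g 1 0 = - val M 0 0.
  by split; rewrite SL2Z_mulE !mxE /=; ring.
have upR (M : SL2Z) : P (matR * M)%g -> P M.
  by rewrite -{2}[M](mulKg matR); apply: PRV.
have upRV (M : SL2Z) : P (matR^-1 * M)%g -> P M.
  by rewrite -{2}[M](mulVKg matR); apply: PR.
have upS (M : SL2Z) : P (matS * M)%g -> P M.
  by rewrite -{2}[M](mulKg matS); apply: PSV.
have upper n (M : SL2Z) : (`|(val M 0 1)%R| <= n)%N -> val M 1 0 = 0 -> P M.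
  elim: n M => [|n IH] M bn c0.
    have := SL2Z_detE M; rewrite c0 mulr0 subr0 => ad.
    have b0 : val M 0 1 = 0 by lia.
    have [[a1 d1]|[a1 d1]] := intz_mul_eq1 ad.
      by suff -> : M = 1%g by []; apply: SL2Z_ext; rewrite ?a1 ?b0 ?c0 ?d1 !mxE.
    apply/upS/upS; suff -> : (matS * (matS * M))%g = 1%g by [].
    by apply: SL2Z_ext; rewrite matS2E ?a1 ?b0 ?c0 ?d1 !mxE.
  have := SL2Z_detE M; rewrite c0 mulr0 subr0 => /intz_mul_eq1 ad.
  have [bn'|[Rb|RVb]] : (`|(val M 0 1)%R| <= n)%N \/
      (`|(val M 0 1 + val M 1 1)%R| <= n)%N \/
      (`|(val M 0 1 - val M 1 1)%R| <= n)%N by lia.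
  - exact: IH.
  - by apply: upR; have [_ e1 e2 _] := RE M; apply: IH; rewrite ?e1 ?e2.
  - by apply: upRV; have [_ e1 e2 _] := RVE M; apply: IH; rewrite ?e1 ?e2.
move=> M; have [n] := ubnP (`|(val M 0 0)%R| + `|(val M 1 0)%R|)%N.
elim: n M => // n IH M.
have descent (N : SL2Z) : (`|(val N 0 0)%R| + `|(val N 1 0)%R| < n.+1)%N ->
    val N 1 0 <> 0 -> (`|(val N 1 0)%R| <= `|(val N 0 0)%R|)%N -> P N.
  move=> Nn c0 ca.
  have [Rn|RVn] :
      (`|(val N 0 0 + val N 1 0)%R| + `|(val N 1 0)%R| < n)%N \/
      (`|(val N 0 0 - val N 1 0)%R| + `|(val N 1 0)%R| < n)%N by lia.
  - by apply: upR; apply: IH; have [-> _ -> _] := RE N.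
  - by apply: upRV; apply: IH; have [-> _ -> _] := RVE N.
move=> Mn.
case: (eqVneq (val M 1 0) 0) => [c0|/eqP c0]; first exact: (upper `|(val M 0 1)%R|%N).
case: (leqP `|(val M 1 0)%R|%N `|(val M 0 0)%R|%N) => [ca|ac]; first exact: descent.
apply: upS; have [e0 e1] := SE M.
case: (eqVneq (val M 0 0) 0) => [a0|/eqP a0].
  by apply: (upper _ _ (leqnn _)); rewrite e1 a0 oppr0.
by apply: descent; rewrite ?e0 ?e1; lia.
Qed.

Lemma SL2Z_reducible (M : SL2Z) : reducible_form matS matT M.
Proof.
move: M; apply: SL2Z_generated.
- exact: reducible_form1.
- by move=> M; apply: reducible_formS.
- by move=> M; apply: (reducible_formT matS4 matT3 matS2T).
Qed.

Lemma SL2Z_tame (M : SL2Z) : tame matS matT M.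
Proof.
have [c [s [d ->]]] := SL2Z_reducible M.
apply: (@tame_conj _ _ _ (matS ^+ d)%g).
have -> : (matS ^+ d * (matS ^+ c * word matS matT s * matS ^+ d) * (matS ^+ d)^-1 =
    matS ^+ (d + c) * word matS matT s)%g by rewrite mulgA mulgK expgnDr mulgA.
exact: (tame_form matS4 matT3 matS2T).
Qed.

End Generation.

(** * Degrees on the image of theta *)

Section Image.
Variables (F : fieldType) (mu : F) (k : nat) (k_gt0 : (0 < k)%N).
Hypotheses (k_gt1 : (1 < k)%N) (mu_isotropy : trivial_isotropy mu).
Variable theta : {multiplicative SL2Z -> Bir F}.
Hypothesis theta_S : theta matS = theta_e F matS.
Hypothesis theta_RS : theta matT =
  (psi mu k_gt0 * theta_e F matT * (psi mu k_gt0)^-1)%g.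
Implicit Types M N : SL2Z.
Local Notation W := (word matS matT).

Definition reduced (f : Bir F) d := exists t,
  [/\ represents f t, primitive t & forall i, tnth t i \is d.-homog].

Lemma reduced_degree f d : reduced f d -> degree f = d.
Proof. by move=> [t [[ht ->] tp td]]; apply: primitive_degree. Qed.

Lemma reduced_mul_le f g d e n :
  reduced f d -> reduced g e -> reduced (f * g)%g n -> (n <= d * e)%N.
Proof.
move=> [t [tf _ td]] [s [sg _ se]] [u [[hu uE] up un]].
have [hts tsE] := representsM tf sg.
rewrite mulnC; apply: (primitive_degree_le (ht := hu) (hs := hts) up un).
  exact: comp3_homog.
by rewrite -uE.
Qed.

Lemma theta_expS n : theta (matS ^+ n)%g = theta_e F (matS ^+ n)%g.
Proof.
elim: n => [|n IH]; first by rewrite multiplicative1 theta_e1.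
by rewrite expgS gmulfM theta_S IH theta_eM.
Qed.

(** Composing on the left with [S^c] moves the contraction-free point [p] to
    [S^c p], the zero of [l S^(-c)]. *)
Lemma theta_reduced c s d :
  reduced (theta (matS ^+ c * W s * matS ^+ d)%g) (k ^ (2 * size s)).
Proof.
have [t [rt td tM]] :=
  word_represents k_gt1 mu_isotropy theta_S theta_RS s (theta_expS d).
exists (comp3 (linear_triple F (matS ^+ c)%g) t); split.
- have -> : (matS ^+ c * W s * matS ^+ d = matS ^+ c * (W s * matS ^+ d))%g.
    by rewrite mulgA.
  by rewrite gmulfM theta_expS; apply: represents_theta_e.
- apply: (@avoids_primitive _ _ (lcoef1 mu (matS ^+ c)^-1%g)
    (lcoef2 mu (matS ^+ c)^-1%g)).
  by rewrite avoids_lcoef_linear mulVg; apply/tM/admissible1.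
- exact: comp3_linear_homog.
Qed.

Lemma theta_degree M : exists n, reduced (theta M) (k ^ n).
Proof.
have [c [s [d ->]]] := SL2Z_reducible M.
by exists (2 * size s)%N; apply: theta_reduced.
Qed.

(** The composite of primitive triples for the two factors represents the
    product, so it is a multiple of a primitive triple for the product. *)
Lemma degree_theta_mul_le M N :
  (degree (theta (M * N)%g) <= degree (theta M) * degree (theta N))%N.
Proof.
have [[m hM] [n hN] [p hMN]] :=
  And3 (theta_degree M) (theta_degree N) (theta_degree (M * N)%g).
rewrite (reduced_degree hM) (reduced_degree hN) (reduced_degree hMN).
by apply: (reduced_mul_le hM hN); rewrite -gmulfM.
Qed.

Lemma degree_theta_gt0 M : (0 < degree (theta M))%N.
Proof. by have [n /reduced_degree ->] := theta_degree M; rewrite expn_gt0 k_gt0. Qed.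

Lemma degree_theta_word s : degree (theta (W s)) = (k ^ (2 * size s))%N.
Proof.
have := theta_reduced 0 s 0; rewrite !expg0 mul1g mulg1; exact: reduced_degree.
Qed.

(** Conjugation changes the degrees of the powers by a bounded factor. *)
Lemma degree_conj_bounds s g : exists2 C, (0 < C)%N & forall n,
  let u := degree (theta ((g * W s * g^-1) ^+ n)%g) in
  ((k ^ (2 * size s)) ^ n <= C * u)%N /\ (u <= C * (k ^ (2 * size s)) ^ n)%N.
Proof.
exists (degree (theta g) * degree (theta g^-1%g))%N.
  by rewrite muln_gt0 !degree_theta_gt0.
move=> n; rewrite /= expg_conj; have [s' ss' ->] := word_exp matS matT s n.
have <- : degree (theta (W s')) = ((k ^ (2 * size s)) ^ n)%N.
  by rewrite degree_theta_word ss' -expnM; congr (_ ^ _)%N; lia.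
split.
  have {1}-> : W s' = (g^-1 * (g * W s' * g^-1) * g)%g.
    by rewrite !mulgA mulVg mul1g mulgVK.
  apply: leq_trans (degree_theta_mul_le _ _) _.
  rewrite mulnC -mulnA leq_mul2l; apply/orP; right.
  exact: degree_theta_mul_le.
apply: leq_trans (degree_theta_mul_le _ _) _.
rewrite mulnAC leq_mul2r; apply/orP; right; exact: degree_theta_mul_le.
Qed.

Lemma degree_torsion_bounds M : (M ^+ 12 = 1)%g -> exists2 C, (0 < C)%N & forall n,
  let u := degree (theta (M ^+ n)%g) in (1 ^ n <= C * u)%N /\ (u <= C * 1 ^ n)%N.
Proof.
move=> M12; pose C := (\sum_(i < 12) degree (theta (M ^+ i)%g))%N.
have uC n : (degree (theta (M ^+ n)%g) <= C)%N.
  have -> : (M ^+ n = M ^+ (n %% 12))%g.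
    by rewrite {1}(divn_eq n 12) expgnDr mulnC expgnA M12 expg1n mul1g.
  have lt12 : (n %% 12 < 12)%N by rewrite ltn_mod.
  by rewrite /C (bigD1 (Ordinal lt12)) //= leq_addr.
have C0 : (0 < C)%N by apply: leq_trans (uC 0%N); apply: degree_theta_gt0.
by exists C => // n /=; rewrite exp1n muln1 uC muln_gt0 C0 degree_theta_gt0.
Qed.

(** The degree of the image confines the kernel to the powers of [S], and
    [theta S^2] is [(- x : - y : z)], different from the identity because
    [2 != 0]. *)
Lemma theta_injective : (2%:R != 0 :> F) -> injective theta.
Proof.
move=> two0 M N MN.
have K1 : theta (M * N^-1)%g = 1%g by rewrite gmulfM multiplicativeV MN mulgV.
suff K : (M * N^-1 = 1)%g by apply: (mulIg N^-1%g); rewrite K mulgV.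
have [c [s [d KE]]] := SL2Z_reducible (M * N^-1)%g.
have s0 : s = [::].
  have := reduced_degree (theta_reduced c s d); rewrite -KE K1.
  rewrite -(multiplicative1 theta) -(word_nil matS matT) degree_theta_word muln0.
  rewrite expn0 => /eqP; rewrite -[1%N](expn0 k) eqn_exp2l // eq_sym muln_eq0 /=.
  by move/eqP/size0nil.
have thS2 : theta (matS ^+ 2)%g <> 1%g.
  rewrite theta_expS => /bir_eq /same_mapP /(_ (@Ordinal 3 0 isT) (@Ordinal 3 2 isT)).
  have S2 i j : val (matS ^+ 2)%g i j = - (i == j)%:R.
    have -> : (matS ^+ 2 = matS * (matS * 1))%g by rewrite mulg1.
    by rewrite matS2E !mxE.
  rewrite !tnth_id3 !(tnth_nth 0) /= !S2 /= oppr0 scale0r addr0.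
  rewrite rmorphN1 scaleN1r => e.
  set x := 'X_(@Ordinal 3 0 isT) in e; set z := 'X_(@Ordinal 3 2 isT) in e.
  have : (2%:R : F)%:MP * (x * z) = 0 :> {mpoly F[3]}.
    rewrite rmorph_nat mulr_natl mulr2n -{2}[x * z]opprK -mulNr e.
    by rewrite [z * x]mulrC subrr.
  by apply/eqP; rewrite !mulf_neq0 ?mpolyXU_neq0 // mpolyC_eq0.
move: K1; rewrite KE s0 word_nil mulg1 -expgnDr; move: (c + d)%N => n thSn.
case: (boolP (odd n)) => n_odd; last first.
  have [// | Sn] := expS_even matS4 n_odd.
  by case: thS2; rewrite -Sn.
have e : (matS ^+ (n + n) = matS ^+ 2)%g.
  rewrite -[n]odd_double_half n_odd -addnn.
  have -> : (1 + (n./2 + n./2) + (1 + (n./2 + n./2)) = 4 * n./2 + 2)%N by lia.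
  by rewrite expgnDr expgnA matS4 expg1n mul1g.
by case: thS2; rewrite -e expgnDr gmulfM thSn mulg1.
Qed.

End Image.

(** * Dynamical degrees *)

Local Open Scope classical_set_scope.

Lemma powR_harmonic_cvg (R : realType) (c : R) : 0 < c ->
  c `^ n.+1%:R^-1 @[n --> \oo] --> (1 : R).
Proof.
move=> c0.
have -> : (fun n : nat => c `^ n.+1%:R^-1) =
    expR \o (fun n : nat => (@harmonic R) n * ln c).
  by apply/funext => n; rewrite /= /powR gt_eqF.
rewrite -(expR0 R); apply: continuous_cvg; first exact: continuous_expR.
rewrite -[X in _ --> X](mul0r (ln c)); apply: cvgM.
  exact: cvg_harmonic.
exact: cvg_cst.
Qed.

(** The n-th roots of [D ^ n / C] and [C D ^ n] both tend to [D]. *)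
Lemma root_limit (R : realType) (u : nat -> nat) (D C : nat) :
  (0 < D)%N -> (0 < C)%N ->
  (forall n, (D ^ n <= C * u n)%N /\ (u n <= C * D ^ n)%N) ->
  limn (fun n : nat => (u n)%:R `^ n%:R^-1) = D%:R :> R.
Proof.
move=> D0 C0 uDC; apply: cvg_lim; first exact: norm_hausdorff.
rewrite -cvg_shiftS.
have D0' : 0 <= D%:R :> R by [].
have C0' : 0 < C%:R :> R by rewrite ltr0n.
have lim (c : R) : 0 < c -> c `^ n.+1%:R^-1 * D%:R @[n --> \oo] --> (D%:R : R).
  move=> c0; rewrite -[X in _ --> X]mul1r; apply: cvgM; last exact: cvg_cst.
  exact: powR_harmonic_cvg.
apply: squeeze_cvgr (lim (C%:R^-1) _) (lim C%:R _); rewrite ?invr_gt0 //.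
apply: nearW => n /=; have [lo up] := uDC n.+1.
have root (c : R) : 0 < c -> c `^ n.+1%:R^-1 * D%:R =
    (c * D%:R ^+ n.+1) `^ n.+1%:R^-1 :> R.
  move=> c0; rewrite powRM ?exprn_ge0 ?(ltW c0) // -(powR_mulrn n.+1 D0') -powRrM.
  by rewrite divff ?pnatr_eq0 // powRr1.
rewrite !root ?invr_gt0 //.
have mono (x y : R) : 0 <= x -> x <= y -> x `^ n.+1%:R^-1 <= y `^ n.+1%:R^-1.
  move=> x0 xy; apply: ge0_ler_powR; rewrite ?nnegrE ?invr_ge0 //.
  exact: le_trans xy.
apply/andP; split; apply: mono => //.
- by rewrite mulr_ge0 ?exprn_ge0 // invr_ge0 ltW.
- by rewrite ler_pdivrMl // -natrX -natrM ler_nat.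
- by rewrite -natrX -natrM ler_nat.
Qed.

Section Dynamics.
Variables (R : realType) (mu : R[i]) (k : nat) (k_gt0 : (0 < k)%N).
Hypotheses (k_gt1 : (1 < k)%N) (mu_isotropy : trivial_isotropy mu).
Variable theta : {multiplicative SL2Z -> Bir R[i]}.
Hypothesis theta_S : theta matS = theta_e R[i] matS.
Hypothesis theta_RS : theta matT =
  (psi mu k_gt0 * theta_e R[i] matT * (psi mu k_gt0)^-1)%g.

Lemma dynamical_degree_theta M (D C : nat) : (0 < D)%N -> (0 < C)%N ->
  (forall n, let u := degree (theta (M ^+ n)%g) in
     (D ^ n <= C * u)%N /\ (u <= C * D ^ n)%N) ->
  dynamical_degree (theta M) = D%:R.
Proof.
move=> D0 C0 h; rewrite /dynamical_degree.
have -> : (fun n : nat => (degree (theta M ^+ n)%g)%:R `^ n%:R^-1 : R) =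
    (fun n => (degree (theta (M ^+ n)%g))%:R `^ n%:R^-1).
  by apply/funext => n; rewrite multiplicativeX.
exact: root_limit D0 C0 h.
Qed.

Lemma dynamical_degree_word_conj s g :
  dynamical_degree (theta (g * word matS matT s * g^-1)%g) = k%:R ^+ (2 * size s).
Proof.
have [C C0 h] := degree_conj_bounds k_gt1 mu_isotropy theta_S theta_RS s g.
by rewrite (dynamical_degree_theta _ C0 h) ?natrX // expn_gt0 k_gt0.
Qed.

Lemma dynamical_degree_word s :
  dynamical_degree (theta (word matS matT s)) = k%:R ^+ (2 * size s).
Proof. by have := dynamical_degree_word_conj s 1%g; rewrite mul1g invg1 mulg1. Qed.

Lemma dynamical_degree_torsion M : (M ^+ 12 = 1)%g -> dynamical_degree (theta M) = 1.
Proof.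
move=> /(degree_torsion_bounds k_gt1 mu_isotropy theta_S theta_RS)[C C0 h].
exact: (dynamical_degree_theta (D := 1%N) _ C0 h).
Qed.

End Dynamics.

Lemma wordSR_word m (a b : 'I_m -> int) :
  (forall i, a i = 1 \/ a i = -1) -> (forall i, b i = 1 \/ b i = -1) ->
  exists2 s, size s = m & wordSR a b = word matS matT s.
Proof.
move=> ha hb.
exists [seq (b (rev_ord i) == 1, a (rev_ord i) == 1) | i <- index_enum 'I_m].
  by rewrite size_map [index_enum _]unlock -enumT size_enum_ord.
rewrite /word big_map; apply: eq_bigr => i _.
have zexpgE (g : SL2Z) e : e = 1 \/ e = -1 -> zexpg g e = signed g (e == 1).
  by case=> ->; rewrite /signed /= ?expg1.
by rewrite !zexpgE.
Qed.

Theorem corollary3p11 (R : realType) (mu : R[i]) (k : nat)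
  (k_gt0 : (0 < k)%N) (k_even : ~~ odd k)
  (mu_neq0 : mu != 0) (mu_isotropy : trivial_isotropy mu)
  (theta : {multiplicative SL2Z -> Bir R[i]})
  (theta_S : theta matS = theta_e R[i] matS)
  (theta_RS : theta (matR * matS)%g =
    (psi mu k_gt0 * theta_e R[i] (matR * matS) * (psi mu k_gt0)^-1)%g) :
  [/\ forall (m : nat) (a b : 'I_m -> int), (0 < m)%N ->
        (forall i, a i = 1 \/ a i = -1) -> (forall i, b i = 1 \/ b i = -1) ->
        dynamical_degree (theta (wordSR a b)) = k%:R ^+ (2 * m),
      hyperbolic_embedding theta &
      range (fun M : SL2Z => dynamical_degree (theta M)) =
      range (fun n : nat => k%:R ^+ (2 * n))].
Proof.
have k_gt1 : (1 < k)%N by case: k k_gt0 k_even {theta_RS} => [|[]].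
have tame M := SL2Z_tame M.
have degW := dynamical_degree_word k_gt1 mu_isotropy theta_S theta_RS.
have degWJ := dynamical_degree_word_conj k_gt1 mu_isotropy theta_S theta_RS.
have degT := dynamical_degree_torsion k_gt1 mu_isotropy theta_S theta_RS.
split.
- move=> m a b _ ha hb; have [s sm ->] := wordSR_word ha hb.
  by rewrite degW sm.
- split.
    by apply: (theta_injective k_gt1 mu_isotropy theta_S theta_RS); rewrite pnatr_eq0.
  move=> f [M <-] inf; case: (tame M) => [M12|[s [g [s0 ->]]]].
    by case: (inf 12%N) => //; rewrite -multiplicativeX M12 multiplicative1.
  rewrite /hyperbolic degWJ exprn_egt1 ?ltr1n // muln_eq0 /=.
  by rewrite size_eq0.
- apply/seteqP; split => [_ [M _ <-]|_ [n _ <-]].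
    case: (tame M) => [M12|[s [g [_ ->]]]].
      by exists 0%N => //; rewrite degT.
    by exists (size s) => //; rewrite degWJ.
  exists (word matS matT (nseq n (true, true))) => //.
  by rewrite degW size_nseq.
Qed.
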